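(* Let $k$ be a field of characteristic $p>0$, let $1\le c\le d$ be integers, and let $R=k[x_1,\ldots,x_c]\,\#\,k[y_1,\ldots,y_d]$ be the Segre product of the polynomial rings over $k$ in $c$ and $d$ variables, respectively. Then $$e_{HK}(R)=\frac{d!}{(c+d-1)!}\,S(c+d-1,d)-\frac1{(c+d-1)!}\sum_{0<j<i\le c}\binom ci\binom dj(-1)^{c-i+j}(i-j)^{c+d-1},$$ where $S(n,k)$ denotes the Stirling number of the second kind. In particular, if $c=2$, then $$e_{HK}(R)=d\left(\frac12+\frac1{(d+1)!}\right).$$
   Context: The Segre product of two $\mathbb N$-graded $k$-algebras $B=\bigoplus_{n\ge0}B_n$ and $C=\bigoplus_{n\ge0}C_n$ is the graded ring $B\#C=\bigoplus_{n\ge0}B_n\otimes_kC_n$; polynomial rings carry the standard grading. For a graded ring $R$ of characteristic $p>0$ with unique homogeneous maximal ideal $P$, $e_{HK}(R)$ is the Hilbert-Kunz multiplicity of the local ring $R_P$, i.e. $e_{HK}(R)=\lim_{e\to\infty}l(R_P/P^{[q]}R_P)/q^{\dim R_P}$ where $q=p^e$, $l$ is length, and $P^{[q]}$ is the ideal generated by the $q$-th powers of elements of $P$. The Stirling numbers of the second kind $S(n,k)$ are the integers defined by $x^n=\sum_{k\ge0}S(n,k)\,x(x-1)\cdots(x-k+1)$. *)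

(* Defs.v *)
From HB Require Import structures.
From mathcomp Require Import all_boot all_order all_algebra.
From mathcomp Require mpoly.
(* Some notations of mpoly clash with those of MathComp-Analysis. *)
Import -(notations) mpoly.
From mathcomp Require Import boolp classical_sets reals.
From mathcomp Require Import topology normedtype sequences.
From mathcomp Require Import ring.

Set Implicit Arguments.
Unset Strict Implicit.
Unset Printing Implicit Defensive.

Import Order.TTheory GRing.Theory Num.Theory.
Import numFieldNormedType.Exports.
Local Open Scope ring_scope.
Local Open Scope quotient_scope.

(* Submodules are MathComp's [submodClosed M], ideals of A are submodules of
   the regular module A^o; rings may be zero ([comPzRingType]). *)

Section Modules.
Variables (A : comPzRingType) (M : lmodType A).

Definition span_pred (X : set M) : {pred M} := fun x =>
  `[< exists (n : nat) (a : 'I_n -> A) (g : 'I_n -> M),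
        (forall i, X (g i)) /\ x = \sum_(i < n) a i *: g i >].

Lemma span_submod_closed (X : set M) : submod_closed (span_pred X).
Proof.
split.
  by apply/asboolP; exists 0, (fun=> 0), (fun=> 0); split=> [[]//|]; rewrite big_ord0.
move=> a u v /asboolP[m [b [g [Xg ->]]]] /asboolP[n [b' [g' [Xg' ->]]]].
apply/asboolP; exists (m + n)%N.
exists (fun i => match split i with inl j => a * b j | inr j => b' j end).
exists (fun i => match split i with inl j => g j | inr j => g' j end).
split=> [i|]; first by case: (split i).
rewrite big_split_ord /= scaler_sumr; congr (_ + _); apply: eq_bigr => i _.
  by rewrite (unsplitK (inl i)) scalerA.
by rewrite (unsplitK (inr i)).
Qed.

HB.instance Definition _ (X : set M) :=
  GRing.isSubmodClosed.Build A M (span_pred X) (span_submod_closed X).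

Definition span (X : set M) : submodClosed M := span_pred X.

Section QuotMod.
Variable N : submodClosed M.

(* [submodClosed] does not inherit from [zmodClosed], which [Quotient.quot]
   expects. *)
Definition zmod_pred : {pred M} := fun x => x \in N.

Lemma zmod_pred_closed : zmod_closed zmod_pred.
Proof.
split; first exact: rpred0.
move=> x y Nx Ny; rewrite -topredE /= /zmod_pred -scaleN1r.
by apply: rpredD => //; apply: rpredZ.
Qed.

HB.instance Definition _ := GRing.isZmodClosed.Build M zmod_pred zmod_pred_closed.

Definition quotmod : Type := Quotient.quot zmod_pred.
HB.instance Definition _ := GRing.Zmodule.on quotmod.

Definition qpi (x : M) : quotmod := \pi_(Quotient.quot zmod_pred) x.

Lemma qpi_surj (y : quotmod) : exists x, y = qpi x.
Proof. by exists (repr (y : Quotient.quot zmod_pred)); rewrite /qpi reprK. Qed.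

Lemma qpi_eq x y : (qpi x = qpi y) <-> (x - y \in N).
Proof.
rewrite -[_ \in N]/(zmod_pred _) -[zmod_pred _]/(x - y \in zmod_pred).
by rewrite Quotient.idealrBE; split=> /eqP.
Qed.

Lemma qpiD : {morph qpi : x y / x + y}.
Proof. exact: (raddfD (\pi_(Quotient.quot zmod_pred))). Qed.

Definition qscale (a : A) (y : quotmod) : quotmod :=
  qpi (a *: repr (y : Quotient.quot zmod_pred)).

Lemma qscale_pi a x : qscale a (qpi x) = qpi (a *: x).
Proof.
apply/qpi_eq; rewrite -scalerBr; apply: rpredZ; apply/qpi_eq.
by rewrite /qpi reprK.
Qed.

Lemma qscaleA a b y : qscale a (qscale b y) = qscale (a * b) y.
Proof. by have [x ->] := qpi_surj y; rewrite !qscale_pi scalerA. Qed.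

Lemma qscale1 : left_id 1 qscale.
Proof. by move=> y; have [x ->] := qpi_surj y; rewrite qscale_pi scale1r. Qed.

Lemma qscaleDr : right_distributive qscale +%R.
Proof.
move=> a y z; have [x ->] := qpi_surj y; have [x' ->] := qpi_surj z.
by rewrite -qpiD !qscale_pi scalerDr qpiD.
Qed.

Lemma qscaleDl y : {morph qscale^~ y : a b / a + b}.
Proof.
by move=> a b; have [x ->] := qpi_surj y; rewrite !qscale_pi scalerDl qpiD.
Qed.

HB.instance Definition _ := GRing.Zmodule_isLmodule.Build A (quotmod)
  qscaleA qscale1 qscaleDr qscaleDl.
End QuotMod.

Definition strict_sub (N N' : submodClosed M) : Prop :=
  {subset N <= N'} /\ ~ {subset N' <= N}.

Definition is_length (l : nat) : Prop :=
  (exists N : nat -> submodClosed M,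
     forall i, (i < l)%N -> strict_sub (N i) (N i.+1)) /\
  (forall (m : nat) (N : nat -> submodClosed M),
     (forall i, (i < m)%N -> strict_sub (N i) (N i.+1)) -> (m <= l)%N).

End Modules.

Section Ideals.
Variable A : comPzRingType.

Definition is_prime (I : submodClosed A^o) : Prop :=
  (1 : A) \notin I /\
  forall x y : A, x * y \in I -> x \in I \/ y \in I.

Record prime_ideal := PrimeIdeal {
  prime_carrier :> submodClosed A^o;
  primeP : is_prime prime_carrier }.

Definition is_maximal (I : submodClosed A^o) : Prop :=
  (1 : A) \notin I /\
  forall J : submodClosed A^o, {subset I <= J} -> (1 : A) \notin J ->
    {subset J <= I}.

Definition is_krull_dim (n : nat) : Prop :=
  (exists Q : nat -> prime_ideal,
     forall i, (i < n)%N -> strict_sub (Q i) (Q i.+1)) /\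
  (forall (m : nat) (Q : nat -> prime_ideal),
     (forall i, (i < m)%N -> strict_sub (Q i) (Q i.+1)) -> (m <= n)%N).

(* Spanned by the q-th powers of the elements of I: the ideal I^[q]. *)
Definition frobenius_power (q : nat) (I : submodClosed A^o) : submodClosed A^o :=
  span (fun y : A^o => exists2 x : A, x \in I & y = x ^+ q).

End Ideals.

Definition extend_ideal (A B : comPzRingType) (f : A -> B)
    (I : submodClosed A^o) : submodClosed B^o :=
  span (fun y : B^o => exists2 x : A, x \in I & y = f x).

Section Localization.
Variables (A : comPzRingType) (P : prime_ideal A).

Record denom := Denom { den_val : A; den_notin : den_val \notin P }.
HB.instance Definition _ := [isSub for den_val].
HB.instance Definition _ := [Choice of denom by <:].

Definition prefrac := (A * denom)%type.

Lemma denom1_subproof : (1 : A) \notin P.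
Proof. by case: (primeP P). Qed.
Definition denom1 : denom := Denom denom1_subproof.

Lemma denomM_subproof (s t : denom) : den_val s * den_val t \notin P.
Proof.
by apply/negP => /(primeP P).2 []; apply/negP; apply: den_notin.
Qed.
Definition denomM (s t : denom) : denom := Denom (denomM_subproof s t).

Definition loc_eqv (x y : prefrac) : bool :=
  `[< exists u : denom, den_val u * (x.1 * den_val y.2 - y.1 * den_val x.2) = 0 >].

Lemma loc_eqv_refl : reflexive loc_eqv.
Proof. by move=> x; apply/asboolP; exists denom1; rewrite subrr mulr0. Qed.

Lemma loc_eqv_sym : ssrbool.symmetric loc_eqv.
Proof.
suff H x y : loc_eqv x y -> loc_eqv y x by move=> x y; apply/idP/idP; apply: H.
move=> /asboolP[u Hu]; apply/asboolP; exists u.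
by rewrite -[_ - _]opprB mulrN Hu oppr0.
Qed.

Lemma loc_eqv_trans : transitive loc_eqv.
Proof.
move=> y x z /asboolP[u Hu] /asboolP[v Hv]; apply/asboolP.
exists (denomM (denomM u v) y.2) => /=.
have -> : den_val u * den_val v * den_val y.2 * (x.1 * den_val z.2 - z.1 * den_val x.2) =
    den_val v * den_val z.2 * (den_val u * (x.1 * den_val y.2 - y.1 * den_val x.2)) +
    den_val u * den_val x.2 * (den_val v * (y.1 * den_val z.2 - z.1 * den_val y.2)).
  by ring.
by rewrite Hu Hv !mulr0 addr0.
Qed.

Canonical loc_eqv_equiv := EquivRel loc_eqv loc_eqv_refl loc_eqv_sym loc_eqv_trans.

Definition loc : Type := {eq_quot loc_eqv}.
HB.instance Definition _ := Choice.on loc.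

Definition frac (a : A) (s : denom) : loc := \pi_{eq_quot loc_eqv} (a, s).

Lemma frac_surj (x : loc) : exists a s, x = frac a s.
Proof.
exists (repr (x : {eq_quot loc_eqv})).1, (repr (x : {eq_quot loc_eqv})).2.
by rewrite /frac -surjective_pairing reprK.
Qed.

Lemma frac_eq a s b t :
  frac a s = frac b t <->
  exists u : denom, den_val u * (a * den_val t - b * den_val s) = 0.
Proof.
split; first by move/eqP; rewrite eqmodE => /asboolP.
by move=> H; apply/eqP; rewrite eqmodE; apply/asboolP.
Qed.

Definition loc_add (x y : loc) : loc :=
  let r := repr (x : {eq_quot loc_eqv}) in
  let r' := repr (y : {eq_quot loc_eqv}) in
  frac (r.1 * den_val r'.2 + r'.1 * den_val r.2) (denomM r.2 r'.2).

Definition loc_mul (x y : loc) : loc :=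
  let r := repr (x : {eq_quot loc_eqv}) in
  let r' := repr (y : {eq_quot loc_eqv}) in
  frac (r.1 * r'.1) (denomM r.2 r'.2).

Definition loc_opp (x : loc) : loc :=
  let r := repr (x : {eq_quot loc_eqv}) in frac (- r.1) r.2.

Lemma repr_frac a s :
  exists u : denom,
    let r := repr (frac a s : {eq_quot loc_eqv}) in
    den_val u * (r.1 * den_val s - a * den_val r.2) = 0.
Proof. by apply/frac_eq; rewrite /frac -surjective_pairing reprK. Qed.

Lemma loc_addE a s b t :
  loc_add (frac a s) (frac b t) = frac (a * den_val t + b * den_val s) (denomM s t).
Proof.
have [u /= Hu] := repr_frac a s; have [v /= Hv] := repr_frac b t.
rewrite /loc_add; case: (repr (frac a s)) Hu => a' s' /= Hu.
case: (repr (frac b t)) Hv => b' t' /= Hv.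
apply/frac_eq; exists (denomM u v) => /=.
have -> : den_val u * den_val v * ((a' * den_val t' + b' * den_val s') * (den_val s * den_val t) -
    (a * den_val t + b * den_val s) * (den_val s' * den_val t')) =
  den_val v * den_val t' * den_val t * (den_val u * (a' * den_val s - a * den_val s')) +
  den_val u * den_val s * den_val s' * (den_val v * (b' * den_val t - b * den_val t')) by ring.
by rewrite Hu Hv !mulr0 addr0.
Qed.

Lemma loc_mulE a s b t :
  loc_mul (frac a s) (frac b t) = frac (a * b) (denomM s t).
Proof.
have [u /= Hu] := repr_frac a s; have [v /= Hv] := repr_frac b t.
rewrite /loc_mul; case: (repr (frac a s)) Hu => a' s' /= Hu.
case: (repr (frac b t)) Hv => b' t' /= Hv.
apply/frac_eq; exists (denomM u v) => /=.
have -> : den_val u * den_val v * (a' * b' * (den_val s * den_val t) -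
    a * b * (den_val s' * den_val t')) =
  den_val v * b' * den_val t * (den_val u * (a' * den_val s - a * den_val s')) +
  den_val u * a * den_val s' * (den_val v * (b' * den_val t - b * den_val t')) by ring.
by rewrite Hu Hv !mulr0 addr0.
Qed.

Lemma loc_oppE a s : loc_opp (frac a s) = frac (- a) s.
Proof.
have [u /= Hu] := repr_frac a s.
rewrite /loc_opp; case: (repr (frac a s)) Hu => a' s' /= Hu.
apply/frac_eq; exists u.
by have -> : den_val u * (- a' * den_val s - - a * den_val s') =
  - (den_val u * (a' * den_val s - a * den_val s')) by [ring]; rewrite Hu oppr0.
Qed.

Let fracW (T : loc -> Prop) : (forall a s, T (frac a s)) -> forall x, T x.
Proof. by move=> H x; have [a [s ->]] := frac_surj x. Qed.

Let frac_eq1 a s b t : a * den_val t = b * den_val s -> frac a s = frac b t.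
Proof. by move=> H; apply/frac_eq; exists denom1; rewrite H subrr mulr0. Qed.

Lemma loc_addA : associative loc_add.
Proof.
elim/fracW=> a s; elim/fracW=> b t; elim/fracW=> c u.
by rewrite !loc_addE; apply: frac_eq1 => /=; ring.
Qed.
Lemma loc_addC : commutative loc_add.
Proof.
elim/fracW=> a s; elim/fracW=> b t.
by rewrite !loc_addE; apply: frac_eq1 => /=; ring.
Qed.
Lemma loc_add0 : left_id (frac 0 denom1) loc_add.
Proof.
by elim/fracW=> a s; rewrite !loc_addE; apply: frac_eq1 => /=; ring.
Qed.
Lemma loc_addN : left_inverse (frac 0 denom1) loc_opp loc_add.
Proof.
by elim/fracW=> a s; rewrite loc_oppE loc_addE; apply: frac_eq1 => /=; ring.
Qed.
HB.instance Definition _ :=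
  GRing.isZmodule.Build loc loc_addA loc_addC loc_add0 loc_addN.

Lemma loc_mulA : associative loc_mul.
Proof.
elim/fracW=> a s; elim/fracW=> b t; elim/fracW=> c u.
by rewrite !loc_mulE; apply: frac_eq1 => /=; ring.
Qed.
Lemma loc_mulC : commutative loc_mul.
Proof.
elim/fracW=> a s; elim/fracW=> b t.
by rewrite !loc_mulE; apply: frac_eq1 => /=; ring.
Qed.
Lemma loc_mul1 : left_id (frac 1 denom1) loc_mul.
Proof.
by elim/fracW=> a s; rewrite !loc_mulE; apply: frac_eq1 => /=; ring.
Qed.
Lemma loc_mulDl : left_distributive loc_mul +%R.
Proof.
elim/fracW=> a s; elim/fracW=> b t; elim/fracW=> c u.
rewrite -[_ + _]/(loc_add _ _) -[RHS]/(loc_add _ _).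
by rewrite !(loc_addE, loc_mulE); apply: frac_eq1 => /=; ring.
Qed.
HB.instance Definition _ := GRing.Zmodule_isComPzRing.Build loc
  loc_mulA loc_mulC loc_mul1 loc_mulDl.

Definition to_loc (a : A) : loc := frac a denom1.

End Localization.

Section HilbertKunz.
Variable R : realType.

(* v is the limit of l(A_P / I^[q] A_P) / q^(dim A_P) for q = p^e. *)
Definition is_local_HK (p : nat) (A : comPzRingType) (P : prime_ideal A)
    (v : R) : Prop :=
  exists (n : nat) (l : nat -> nat),
    [/\ is_krull_dim (loc P) n,
        forall e : nat, is_length
          (quotmod (extend_ideal (@to_loc A P) (frobenius_power (p ^ e) P)))
          (l e)
      & (((fun e : nat => (l e)%:R / (p ^ e)%:R ^+ n) : nat -> R)
           @ \oo --> v)%classic].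

Lemma is_local_HK_unique (p : nat) (A : comPzRingType) (P : prime_ideal A)
    (v w : R) : is_local_HK p P v -> is_local_HK p P w -> v = w.
Proof.
move=> [n [l [[Q1 Q2] Hl lv]]] [m [l' [[Q1' Q2'] Hl' lw]]].
have nm : n = m.
  case: Q1 Q1' => Q HQ [Q' HQ'].
  by apply/eqP; rewrite eqn_leq (Q2' _ _ HQ) (Q2 _ _ HQ').
have ll : l = l'.
  apply/funext => e; case: (Hl e) (Hl' e) => [[N HN] Nl] [[N' HN'] Nl'].
  by apply/eqP; rewrite eqn_leq (Nl' _ _ HN) (Nl _ _ HN').
by rewrite -nm -ll in lw; apply: cvg_unique lv lw.
Qed.

End HilbertKunz.

Lemma prime_ideal_ext (A : comPzRingType) (P Q : prime_ideal A) :
  P =i Q -> P = Q.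
Proof.
case: P Q => [[P [[p1] [p2]]] hP] [[Q [[q1] [q2]]] hQ] PQ.
have {}PQ : P = Q by apply/funext => x; apply: (PQ x).
subst Q; rewrite (Prop_irrelevance p1 q1) (Prop_irrelevance p2 q2) in hP *.
by rewrite (Prop_irrelevance hP hQ).
Qed.

(* N-graded commutative algebras, the k-algebra structure being given by the
   structure morphism; [ga_comp A n] is the homogeneous component A_n. *)
Record graded_algebra (k : fieldType) := GradedAlgebra {
  ga_sort :> comPzRingType;
  ga_str : {rmorphism k -> ga_sort};
  ga_comp : nat -> set ga_sort;
  ga_comp0 : forall n, ga_comp n 0;
  ga_compZD : forall n (a : k) (x y : ga_sort),
    ga_comp n x -> ga_comp n y -> ga_comp n (ga_str a * x + y);
  ga_comp1 : ga_comp 0%N 1;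
  ga_compM : forall m n (x y : ga_sort),
    ga_comp m x -> ga_comp n y -> ga_comp (m + n)%N (x * y);
  ga_decomp : forall x : ga_sort, exists (N : nat) (y : nat -> ga_sort),
    (forall i, ga_comp i (y i)) /\ x = \sum_(i < N) y i;
  ga_direct : forall (N : nat) (y : nat -> ga_sort),
    (forall i, ga_comp i (y i)) -> \sum_(i < N) y i = 0 ->
    forall i, (i < N)%N -> y i = 0 }.

Section GradedTheory.
Variables (k : fieldType) (A : graded_algebra k).

Lemma ga_compZ n (a : k) (x : A) : ga_comp n x -> ga_comp n (ga_str A a * x).
Proof.
by move=> Ax; rewrite -[_ * x]addr0; apply: ga_compZD => //; apply: ga_comp0.
Qed.

Lemma ga_compN n (x : A) : ga_comp n x -> ga_comp n (- x).
Proof. by move=> Ax; rewrite -mulN1r -(rmorphN1 (ga_str A)); apply: ga_compZ. Qed.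

Lemma ga_comp_str (a : k) : ga_comp 0 (ga_str A a).
Proof. by rewrite -[ga_str A a]mulr1; apply/ga_compZ/ga_comp1. Qed.

Definition is_homogeneous (I : submodClosed (A : comPzRingType)^o) : Prop :=
  forall (N : nat) (y : nat -> A), (forall i, ga_comp i (y i)) ->
    (\sum_(i < N) y i : A) \in I -> forall i, (i < N)%N -> y i \in I.

(* e_HK(A) = v, where A has a unique homogeneous maximal ideal P. *)
Definition is_HK (R : realType) (p : nat) (v : R) : Prop :=
  exists P : prime_ideal A,
    [/\ is_maximal P, is_homogeneous P,
        forall J : submodClosed (A : comPzRingType)^o,
          is_maximal J -> is_homogeneous J -> J =i P
      & is_local_HK p P v].

Lemma is_HK_unique (R : realType) (p : nat) (v w : R) :
  is_HK p v -> is_HK p w -> v = w.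
Proof.
move=> [P [mP hP uP vP]] [Q [mQ hQ uQ wQ]].
have PQ : P = Q by apply: prime_ideal_ext; apply: uQ.
by subst Q; apply: is_local_HK_unique vP wQ.
Qed.

End GradedTheory.

(* The direct sum over n of the tensor products of B_n and C_n. Its elements are
   formal finite sums of terms b (x) c with b in B_n and c in C_n, two such sums
   being equal when they have the same value under every family of k-bilinear
   maps f_n : B_n x C_n -> V, V any k-module (only the values of [f n] on
   B_n x C_n matter). *)
Section Segre.
Variables (k : fieldType) (B C : graded_algebra k).

Record pure_tensor := PureTensor {
  pt_deg : nat;
  pt_l : B;
  pt_r : C;
  pt_lP : ga_comp pt_deg pt_l;
  pt_rP : ga_comp pt_deg pt_r }.
HB.instance Definition _ := gen_eqMixin pure_tensor.
HB.instance Definition _ := gen_choiceMixin pure_tensor.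

Definition bilinear_family (V : lmodType k) (f : nat -> B -> C -> V) : Prop :=
  (forall n (a : k) (b b' : B) (c : C),
     ga_comp n b -> ga_comp n b' -> ga_comp n c ->
     f n (ga_str B a * b + b') c = a *: f n b c + f n b' c) /\
  (forall n (a : k) (b : B) (c c' : C),
     ga_comp n b -> ga_comp n c -> ga_comp n c' ->
     f n b (ga_str C a * c + c') = a *: f n b c + f n b c').

Definition pt_eval (V : lmodType k) (f : nat -> B -> C -> V)
    (s : seq pure_tensor) : V :=
  \sum_(t <- s) f (pt_deg t) (pt_l t) (pt_r t).

Definition segre_eqv (s t : seq pure_tensor) : bool :=
  `[< forall (V : lmodType k) (f : nat -> B -> C -> V),
        bilinear_family f -> pt_eval f s = pt_eval f t >].

Lemma segre_eqv_refl : reflexive segre_eqv.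
Proof. by move=> s; apply/asboolP. Qed.
Lemma segre_eqv_sym : ssrbool.symmetric segre_eqv.
Proof.
by move=> s t; apply/asboolP/asboolP => H V f bf; rewrite H.
Qed.
Lemma segre_eqv_trans : transitive segre_eqv.
Proof.
move=> t s u /asboolP H /asboolP H'; apply/asboolP => V f bf.
by rewrite H // H'.
Qed.
Canonical segre_eqv_equiv :=
  EquivRel segre_eqv segre_eqv_refl segre_eqv_sym segre_eqv_trans.

Definition segre : Type := {eq_quot segre_eqv}.
HB.instance Definition _ := Choice.on segre.

Definition seg_class (s : seq pure_tensor) : segre := \pi_{eq_quot segre_eqv} s.
Definition seg_repr (x : segre) : seq pure_tensor :=
  repr (x : {eq_quot segre_eqv}).

Lemma seg_reprK x : seg_class (seg_repr x) = x.
Proof. exact: reprK. Qed.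

Lemma seg_eq s t : seg_class s = seg_class t <->
  (forall (V : lmodType k) (f : nat -> B -> C -> V),
     bilinear_family f -> pt_eval f s = pt_eval f t).
Proof.
split; first by move/eqP; rewrite eqmodE => /asboolP.
by move=> H; apply/eqP; rewrite eqmodE; apply/asboolP.
Qed.

Definition seg_eval (V : lmodType k) (f : nat -> B -> C -> V) (x : segre) : V :=
  pt_eval f (seg_repr x).

Lemma seg_evalE (V : lmodType k) (f : nat -> B -> C -> V) s :
  bilinear_family f -> seg_eval f (seg_class s) = pt_eval f s.
Proof. by move=> bf; apply: (seg_eq _ _).1 => //; rewrite seg_reprK. Qed.

Lemma seg_ext x y :
  (forall (V : lmodType k) (f : nat -> B -> C -> V),
     bilinear_family f -> seg_eval f x = seg_eval f y) -> x = y.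
Proof. by rewrite -[x]seg_reprK -[y]seg_reprK => H; apply/seg_eq => V f bf;
  rewrite -!seg_evalE ?H. Qed.

Let segW (T : segre -> Prop) : (forall s, T (seg_class s)) -> forall x, T x.
Proof. by move=> H x; rewrite -[x]seg_reprK. Qed.

Lemma pt_eval_nil (V : lmodType k) (f : nat -> B -> C -> V) : pt_eval f [::] = 0.
Proof. by rewrite /pt_eval big_nil. Qed.
Lemma pt_eval_cat (V : lmodType k) (f : nat -> B -> C -> V) s t :
  pt_eval f (s ++ t) = pt_eval f s + pt_eval f t.
Proof. by rewrite /pt_eval big_cat. Qed.

Definition pt_opp (t : pure_tensor) : pure_tensor :=
  PureTensor (ga_compN (pt_lP t)) (pt_rP t).
Definition pt_one : pure_tensor := PureTensor (ga_comp1 B) (ga_comp1 C).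
Definition pt_str (a : k) : pure_tensor :=
  PureTensor (ga_comp_str B a) (ga_comp1 C).
Definition pt_mul (s t : pure_tensor) : pure_tensor :=
  PureTensor (ga_compM (pt_lP s) (pt_lP t)) (ga_compM (pt_rP s) (pt_rP t)).

Lemma bilinear_family0l (V : lmodType k) (f : nat -> B -> C -> V) n c :
  bilinear_family f -> ga_comp n c -> f n 0 c = 0.
Proof.
move=> [fl _] Cc; have := fl n (-1) 0 0 c (ga_comp0 B n) (ga_comp0 B n) Cc.
by rewrite mulr0 addr0 scaleN1r addNr.
Qed.

Lemma bilinear_familyZl (V : lmodType k) (f : nat -> B -> C -> V) n a b c :
  bilinear_family f -> ga_comp n b -> ga_comp n c ->
  f n (ga_str B a * b) c = a *: f n b c.
Proof.
move=> bf Bb Cc; rewrite -[_ * b]addr0 bf.1 ?bilinear_family0l ?addr0 //.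
exact: ga_comp0.
Qed.

Lemma bilinear_familyNl (V : lmodType k) (f : nat -> B -> C -> V) n b c :
  bilinear_family f -> ga_comp n b -> ga_comp n c -> f n (- b) c = - f n b c.
Proof.
move=> bf Bb Cc; rewrite -mulN1r -(rmorphN1 (ga_str B)).
by rewrite bilinear_familyZl // scaleN1r.
Qed.

Lemma pt_eval_opp (V : lmodType k) (f : nat -> B -> C -> V) s :
  bilinear_family f -> pt_eval f (map pt_opp s) = - pt_eval f s.
Proof.
move=> bf; rewrite /pt_eval big_map -sumrN; apply: eq_bigr => t _ /=.
by rewrite bilinear_familyNl //; [apply: pt_lP | apply: pt_rP].
Qed.

Definition seg_add (x y : segre) : segre := seg_class (seg_repr x ++ seg_repr y).
Definition seg_opp (x : segre) : segre := seg_class (map pt_opp (seg_repr x)).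
Definition seg_mul (x y : segre) : segre :=
  seg_class [seq pt_mul s t | s <- seg_repr x, t <- seg_repr y].
Definition seg_str (a : k) : segre := seg_class [:: pt_str a].

Lemma seg_eval_add (V : lmodType k) (f : nat -> B -> C -> V) x y :
  bilinear_family f -> seg_eval f (seg_add x y) = seg_eval f x + seg_eval f y.
Proof. by move=> bf; rewrite seg_evalE // pt_eval_cat. Qed.

Lemma seg_eval_opp (V : lmodType k) (f : nat -> B -> C -> V) x :
  bilinear_family f -> seg_eval f (seg_opp x) = - seg_eval f x.
Proof. by move=> bf; rewrite seg_evalE // pt_eval_opp. Qed.

Lemma seg_eval0 (V : lmodType k) (f : nat -> B -> C -> V) :
  bilinear_family f -> seg_eval f (seg_class [::]) = 0.
Proof. by move=> bf; rewrite seg_evalE // pt_eval_nil. Qed.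

Lemma seg_addA : associative seg_add.
Proof. by move=> x y z; apply: seg_ext => V f bf; rewrite !seg_eval_add // addrA. Qed.
Lemma seg_addC : commutative seg_add.
Proof. by move=> x y; apply: seg_ext => V f bf; rewrite !seg_eval_add // addrC. Qed.
Lemma seg_add0 : left_id (seg_class [::]) seg_add.
Proof.
by move=> x; apply: seg_ext => V f bf; rewrite seg_eval_add // seg_eval0 // add0r.
Qed.
Lemma seg_addN : left_inverse (seg_class [::]) seg_opp seg_add.
Proof.
move=> x; apply: seg_ext => V f bf.
by rewrite seg_eval_add // seg_eval_opp // seg_eval0 // addNr.
Qed.
HB.instance Definition _ :=
  GRing.isZmodule.Build segre seg_addA seg_addC seg_add0 seg_addN.

Lemma seg_classD s t : seg_class (s ++ t) = seg_class s + seg_class t.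
Proof.
apply: seg_ext => V f bf.
by rewrite [RHS]seg_eval_add // !seg_evalE // pt_eval_cat.
Qed.

Lemma pt_eval_mulC (V : lmodType k) (f : nat -> B -> C -> V) s t :
  pt_eval f [seq pt_mul u v | u <- s, v <- t] =
  pt_eval f [seq pt_mul v u | v <- t, u <- s].
Proof.
rewrite /pt_eval !big_allpairs_dep exchange_big /=.
apply: eq_bigr => u _; apply: eq_bigr => v _.
by rewrite addnC (mulrC (pt_l _)) (mulrC (pt_r _)).
Qed.

Definition shift_family (V : lmodType k) (f : nat -> B -> C -> V)
    (t : pure_tensor) (n : nat) (b : B) (c : C) : V :=
  f (n + pt_deg t)%N (b * pt_l t) (c * pt_r t).

Lemma shift_bilinear (V : lmodType k) (f : nat -> B -> C -> V) t :
  bilinear_family f -> bilinear_family (shift_family f t).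
Proof.
move=> bf; have [Bt Ct] := (pt_lP t, pt_rP t).
split=> n a x y z ? ? ?; rewrite /shift_family mulrDl -mulrA.
  by apply: bf.1; apply: ga_compM.
by apply: bf.2; apply: ga_compM.
Qed.

Lemma pt_eval_mul (V : lmodType k) (f : nat -> B -> C -> V) s t :
  pt_eval f [seq pt_mul u v | u <- s, v <- t] =
  \sum_(v <- t) pt_eval (shift_family f v) s.
Proof. by rewrite /pt_eval big_allpairs_dep exchange_big. Qed.

Lemma seg_mulE s t :
  seg_mul (seg_class s) (seg_class t) =
  seg_class [seq pt_mul u v | u <- s, v <- t].
Proof.
have H s1 s2 s3 : seg_class s1 = seg_class s2 ->
    seg_class [seq pt_mul u v | u <- s1, v <- s3] =
    seg_class [seq pt_mul u v | u <- s2, v <- s3].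
  move=> /seg_eq E; apply/seg_eq => V f bf; rewrite !pt_eval_mul.
  by apply: eq_bigr => v _; apply: E; apply: shift_bilinear.
have K s1 s2 : seg_class [seq pt_mul u v | u <- s1, v <- s2] =
    seg_class [seq pt_mul u v | u <- s2, v <- s1].
  by apply/seg_eq => V f _; apply: pt_eval_mulC.
rewrite /seg_mul (H _ s) ?seg_reprK // K.
by rewrite (H _ t) ?seg_reprK // K.
Qed.

Lemma seg_mulA : associative seg_mul.
Proof.
elim/segW=> s; elim/segW=> t; elim/segW=> u; rewrite !seg_mulE.
apply/seg_eq => V f _; rewrite /pt_eval !big_allpairs_dep.
apply: eq_bigr => x _; rewrite !big_allpairs_dep.
apply: eq_bigr => y _; apply: eq_bigr => z _ /=.
by rewrite addnA !mulrA.
Qed.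
Lemma seg_mulC : commutative seg_mul.
Proof.
elim/segW=> s; elim/segW=> t; rewrite !seg_mulE.
by apply/seg_eq => V f _; apply: pt_eval_mulC.
Qed.
Lemma seg_mul1 : left_id (seg_class [:: pt_one]) seg_mul.
Proof.
elim/segW=> s; rewrite !seg_mulE.
apply/seg_eq => V f _; rewrite /pt_eval big_allpairs_dep big_seq1.
by apply: eq_bigr => t _ /=; rewrite !mul1r.
Qed.
Lemma seg_mulDl : left_distributive seg_mul +%R.
Proof.
elim/segW=> s; elim/segW=> t; elim/segW=> u.
by rewrite -seg_classD !seg_mulE allpairs_cat seg_classD.
Qed.
HB.instance Definition _ := GRing.Zmodule_isComPzRing.Build segre
  seg_mulA seg_mulC seg_mul1 seg_mulDl.

Lemma seg_classM s t :
  seg_class s * seg_class t = seg_class [seq pt_mul u v | u <- s, v <- t].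
Proof. exact: seg_mulE. Qed.

Lemma pt_eval1 (V : lmodType k) (f : nat -> B -> C -> V) t :
  pt_eval f [:: t] = f (pt_deg t) (pt_l t) (pt_r t).
Proof. exact: big_seq1. Qed.

Lemma seg_str_is_zmod : zmod_morphism seg_str.
Proof.
move=> a b; apply: seg_ext => V f bf.
rewrite [RHS]seg_eval_add // [seg_eval f (- _)]seg_eval_opp // !seg_evalE //.
rewrite !pt_eval1 /= -[ga_str B a]mulr1 -[ga_str B b]mulr1.
rewrite -[ga_str B (a - b)]mulr1.
by rewrite !bilinear_familyZl ?scalerBl //; apply: ga_comp1.
Qed.
Lemma seg_str_is_monoid : monoid_morphism seg_str.
Proof.
split; first by apply/seg_eq => V f bf; rewrite !pt_eval1 /= rmorph1.
move=> a b; rewrite seg_classM; apply/seg_eq => V f bf.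
by rewrite /= !pt_eval1 /= rmorphM mulr1.
Qed.
HB.instance Definition _ := GRing.isZmodMorphism.Build k segre seg_str
  seg_str_is_zmod.
HB.instance Definition _ := GRing.isMonoidMorphism.Build k segre seg_str
  seg_str_is_monoid.

Definition seg_comp (n : nat) : set segre := fun x =>
  exists s : seq pure_tensor, (forall t, t \in s -> pt_deg t = n) /\ x = seg_class s.

Lemma seg_comp0 n : seg_comp n 0.
Proof. by exists [::]. Qed.

Lemma seg_compZD n (a : k) (x y : segre) :
  seg_comp n x -> seg_comp n y -> seg_comp n (seg_str a * x + y).
Proof.
move=> [s [Hs ->]] [t [Ht ->]].
exists ([seq pt_mul u v | u <- [:: pt_str a], v <- s] ++ t); split.
  move=> w; rewrite mem_cat => /orP[|/Ht //].
  by move=> /allpairsP[[u v] /= [+ /Hs vn ->]]; rewrite inE => /eqP ->.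
by rewrite seg_classD seg_classM.
Qed.

Lemma seg_comp1 : seg_comp 0 1.
Proof. by exists [:: pt_one]; split=> // t; rewrite inE => /eqP ->. Qed.

Lemma seg_compM m n (x y : segre) :
  seg_comp m x -> seg_comp n y -> seg_comp (m + n) (x * y).
Proof.
move=> [s [Hs ->]] [t [Ht ->]].
exists [seq pt_mul u v | u <- s, v <- t]; split; last by rewrite seg_classM.
by move=> w /allpairsP[[u v] /= [/Hs um /Ht vn ->]] /=; rewrite um vn.
Qed.

Lemma seg_eval_sum (V : lmodType k) (f : nat -> B -> C -> V) N (y : nat -> segre) :
  bilinear_family f ->
  seg_eval f (\sum_(i < N) y i) = \sum_(i < N) seg_eval f (y i).
Proof.
move=> bf; apply: (big_morph (seg_eval f)); last exact: seg_eval0.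
by move=> u v; apply: seg_eval_add.
Qed.

Lemma seg_decomp (x : segre) : exists (N : nat) (y : nat -> segre),
  (forall i, seg_comp i (y i)) /\ x = \sum_(i < N) y i.
Proof.
elim/segW: x => s.
exists (\max_(t <- s) (pt_deg t).+1)%N.
exists (fun i => seg_class [seq t <- s | pt_deg t == i]); split.
  move=> i; exists [seq t <- s | pt_deg t == i]; split=> // t.
  by rewrite mem_filter => /andP[/eqP].
apply: seg_ext => V f bf; rewrite seg_evalE //.
rewrite (seg_eval_sum _ (fun i => seg_class [seq t <- s | pt_deg t == i]) bf).
transitivity (\sum_(i < \max_(t <- s) (pt_deg t).+1) \sum_(t <- s)
    if pt_deg t == i then f (pt_deg t) (pt_l t) (pt_r t) else 0); last first.
  apply: eq_bigr => i _.
  by rewrite seg_evalE // /pt_eval big_filter [RHS]big_mkcond.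
rewrite exchange_big /= /pt_eval big_seq [RHS]big_seq.
apply: eq_bigr => t ts.
have tN : (pt_deg t < \max_(t <- s) (pt_deg t).+1)%N.
  by rewrite (big_rem t) //= leq_maxl.
by rewrite -big_mkcond /= (big_pred1 (Ordinal tN)).
Qed.

Lemma seg_direct (N : nat) (y : nat -> segre) :
  (forall i, seg_comp i (y i)) -> \sum_(i < N) y i = 0 ->
  forall i, (i < N)%N -> y i = 0.
Proof.
move=> Hy y0 i iN; apply: seg_ext => V f bf; rewrite seg_eval0 //.
pose g n b c := if n == i then f n b c else 0.
have bg : bilinear_family g.
  split=> n a u v w *; rewrite /g; case: ifP => _; rewrite ?scaler0 ?addr0 //.
    exact: bf.1.
  exact: bf.2.
have := seg_eval_sum N y bg; rewrite y0 seg_eval0 // (bigD1 (Ordinal iN)) //=.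
rewrite big1 ?addr0 => [|j /eqP ji].
  case: (Hy i) => s [Hs ->]; rewrite !seg_evalE // => E; rewrite [RHS]E.
  rewrite /pt_eval !big_seq; apply: eq_bigr => t /Hs ti.
  by rewrite /g ti eqxx.
case: (Hy j) => s [Hs ->]; rewrite !seg_evalE // /pt_eval big_seq big1 // => t /Hs tj.
by rewrite /g tj; case: eqP => // E; case: ji; apply: val_inj.
Qed.

Definition segre_product : graded_algebra k :=
  @GradedAlgebra k segre seg_str seg_comp seg_comp0 seg_compZD seg_comp1
    seg_compM seg_decomp seg_direct.

End Segre.

Section PolyGraded.
Variables (k : fieldType) (c : nat).
Local Notation P := (mpoly c k).

Definition mp_comp (n : nat) : set P :=
  fun q => q \is ishomog1 n (@mdeg c).

Lemma mp_comp0 n : mp_comp n 0.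
Proof. exact: dhomog0. Qed.

Lemma mp_compZD n (a : k) (x y : P) : mp_comp n x -> mp_comp n y ->
  mp_comp n (mpolyC c a * x + y).
Proof.
move=> Hx Hy; rewrite mul_mpolyC.
by apply: dhomogD => //; apply: dhomogZ.
Qed.

Lemma mp_comp1 : mp_comp 0 1.
Proof. exact: dhomog1. Qed.

Lemma mp_compM m n (x y : P) : mp_comp m x -> mp_comp n y ->
  mp_comp (m + n) (x * y).
Proof. exact: dhomogM. Qed.

Lemma mp_decomp (x : P) : exists (N : nat) (y : nat -> P),
  (forall i, mp_comp i (y i)) /\ x = \sum_(i < N) y i.
Proof.
exists (mmeasure (@mdeg c) x).
exists (fun i => pihomog (@mdeg c) i x); split.
  by move=> i; apply: pihomogP.
exact: pihomog_partitionE.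
Qed.

Lemma mp_direct (N : nat) (y : nat -> P) :
  (forall i, mp_comp i (y i)) -> \sum_(i < N) y i = 0 ->
  forall i, (i < N)%N -> y i = 0.
Proof.
move=> Hy y0 i iN.
have := congr1 (pihomog (@mdeg c) i) y0.
rewrite raddf_sum raddf0 (bigD1 (Ordinal iN)) //= big1 ?addr0 => [|j ji].
  by rewrite pihomog_dE //; apply: Hy.
by apply: pihomog_ne0 (Hy j).
Qed.

(* k[x_1, ..., x_c] with the standard grading. *)
Definition poly_graded : graded_algebra k :=
  @GradedAlgebra k P (@mpolyC c k) mp_comp mp_comp0 mp_compZD mp_comp1
    mp_compM mp_decomp mp_direct.

End PolyGraded.

Section Stirling.

(* S(n, j) for all n, j: the coefficients of 'X^n on the falling factorials. *)
Definition stirling2_spec (S : nat -> nat -> int) : Prop :=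
  forall n : nat, exists N : nat,
    (forall j, (N <= j)%N -> S n j = 0) /\
    'X^n = \sum_(j < N) S n j *: \prod_(i < j) ('X - (i%:R)%:P) :> {poly int}.

Fixpoint stirling2_rec (n j : nat) : int :=
  match n, j with
  | 0, 0 => 1
  | 0, _.+1 => 0
  | n'.+1, 0 => 0
  | n'.+1, j'.+1 => j%:R * stirling2_rec n' j + stirling2_rec n' j'
  end.

Lemma stirling2_rec_spec : stirling2_spec stirling2_rec.
Proof.
have S0 n : forall j, (n < j)%N -> stirling2_rec n j = 0.
  elim: n => [|n IH] [|j] //= nj.
  by rewrite !IH ?mulr0 ?addr0 // ltnW.
move=> n; exists n.+1; split=> [j /S0 //|].
elim: n => [|n IH]; first by rewrite big_ord1 big_ord0 scale1r expr0.
rewrite exprS IH [RHS]big_ord_recl /= scale0r add0r.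
pose F j : {poly int} := \prod_(i < j) ('X - (i%:R)%:P).
have E j : 'X * (stirling2_rec n j *: F j) =
    (j%:R * stirling2_rec n j) *: F j + stirling2_rec n j *: F j.+1.
  rewrite /F big_ord_recr /= -/(F j) -!mul_polyC rmorphM /=; ring.
rewrite mulr_sumr (eq_bigr _ (fun (j : 'I_n.+1) _ => E j)) big_split /=.
rewrite [RHS](eq_bigr (fun j : 'I_n.+1 =>
  (j.+1%:R * stirling2_rec n j.+1) *: F j.+1 + stirling2_rec n j *: F j.+1)).
  rewrite big_split /=; congr (_ + _).
  rewrite big_ord_recl [RHS]big_ord_recr /= !mul0r scale0r add0r.
  by rewrite S0 // mulr0 scale0r addr0.
by move=> j _; rewrite /bump /= add1n scalerDl.
Qed.

Definition stirling2 : nat -> nat -> int :=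
  sval (cid (ex_intro stirling2_spec _ stirling2_rec_spec)).

Lemma stirling2P : stirling2_spec stirling2.
Proof. exact: svalP. Qed.

End Stirling.

(* Main.v *)
(** The Segre product R embeds in the polynomial ring k[x, y] as the span of the
balanced monomials, those of equal degree in x and in y. A chain of primes of
length m yields N^m linearly independent monomials of degree O(N), so counting
balanced monomials bounds the dimension by c + d - 1; killing the variables
one after the other gives a chain of that length. The ideal P^[q] is spanned by
the balanced monomials having some x-exponent and some y-exponent at least q, so
the length of R_P / P^[q] R_P is the number of balanced monomials with all
x-exponents or all y-exponents less than q. By inclusion-exclusion, and after
replacing exponents by q - 1 minus them, this is a combination of coefficients
of products of (1 - X^q)^i / (1 - X)^(c + d), that is, of binomial coefficients
which are polynomials of degree c + d - 1 in q, with explicit leading terms. *)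

Require Import Defs.
From HB Require Import structures.
From mathcomp Require Import all_boot all_order all_algebra.
From mathcomp Require mpoly.
(* Some notations of mpoly clash with those of MathComp-Analysis. *)
Import -(notations) mpoly.
From mathcomp Require Import boolp classical_sets reals.
From mathcomp Require Import topology normedtype sequences.
From mathcomp Require Import ring zify.

Set Implicit Arguments.
Unset Strict Implicit.
Unset Printing Implicit Defensive.

Import Order.TTheory GRing.Theory Num.Theory.
Import numFieldNormedType.Exports.
Local Open Scope ring_scope.
Local Notation span := Defs.span.
Local Notation frac := Defs.frac.
Local Notation primeP := Defs.primeP.
Local Notation "p @_ m" := (mcoeff m p)
  (at level 3, m at level 2, left associativity, format "p @_ m") : ring_scope.

(** Length and dimension are both suprema over chains, so each is pinned down by an upper bound from
    linear algebra over k and by an explicit chain. Localizing is harmless because an element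
    outside P has a non-zero constant term: multiplication by it only rescales the lowest-degree
    part, so the monomial ideals used here are saturated and their chains survive in R_P. In the
    limit, each binomial coefficient becomes a power of a - j over (c + d - 1)!, with a = c or a =
    d. The alternating sum for bounded y-exponents is then a d-th finite difference of a power,
    whence the Stirling number; the one for bounded x-exponents cancels against part of the
    intersection term, and what is left of the latter is the double sum. *)

Lemma linear_dependence (k : fieldType) (m l : nat) (f : 'I_m -> 'I_l -> k) :
  (l < m)%N ->
  exists a : 'I_m -> k,
    (exists i, a i != 0) /\ forall j, \sum_i a i * f i j = 0.
Proof.
move=> lm; pose F := \matrix_(i, j) f i j.
have : kermx F != 0.
  rewrite kermx_eq0 -row_leq_rank -ltnNge.
  by apply: leq_ltn_trans lm; apply: rank_leq_col.
case/rowV0Pn => v /sub_kermxP vF /rV0Pn[i vi].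
exists (v 0); split; first by exists i.
move=> j; have /matrixP/(_ 0 j) := vF; rewrite !mxE => E; rewrite -[RHS]E.
by apply: eq_bigr => h _; rewrite mxE.
Qed.

(** * Spans and ideals *)

Section Span.
Variables (A : comPzRingType) (M : lmodType A).

Lemma span_gen (X : set M) (x : M) : X x -> x \in span X.
Proof.
move=> Xx; apply/asboolP; exists 1%N, (fun=> 1), (fun=> x).
by split=> // ; rewrite big_ord1 scale1r.
Qed.

Lemma span_ind (X : set M) (Y : M -> Prop) :
  Y 0 -> (forall a u v, Y u -> Y v -> Y (a *: u + v)) ->
  (forall x, X x -> Y x) -> forall x, x \in span X -> Y x.
Proof.
move=> Y0 YZD XY x /asboolP[n [a [g [Xg ->]]]].
elim: n a g Xg => [|n IH] a g Xg; first by rewrite big_ord0.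
rewrite big_ord_recl; apply: YZD; first exact/XY/Xg.
by apply: (IH (fun i => a (lift ord0 i)) (fun i => g (lift ord0 i))) => i; apply: Xg.
Qed.

Lemma in_span_closed (X : set M) :
  X 0 -> (forall a u v, X u -> X v -> X (a *: u + v)) ->
  forall x, x \in span X <-> X x.
Proof.
by move=> X0 XZD x; split; [apply: span_ind | apply: span_gen].
Qed.

Lemma sub_chain (N : nat -> submodClosed M) (m : nat) :
  (forall i, (i < m)%N -> strict_sub (N i) (N i.+1)) ->
  forall i j, (i <= j)%N -> (j <= m)%N -> {subset N i <= N j}.
Proof.
move=> H i; elim=> [|j IH]; first by rewrite leqn0 => /eqP -> _ x.
rewrite leq_eqVlt => /orP[/eqP -> _ x //|]; rewrite ltnS => ij jm x Nx.
by apply: (H j jm).1; apply: IH => //; apply: ltnW.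
Qed.

End Span.

Section Ideal.
Variables (A : comPzRingType) (I : submodClosed A^o).

Lemma ideal0 : (0 : A) \in I.
Proof. exact: (rpred0 (V := A^o) I). Qed.

Lemma idealD (x y : A) : x \in I -> y \in I -> x + y \in I.
Proof. exact: (rpredD (V := A^o)). Qed.

Lemma idealM (a x : A) : x \in I -> a * x \in I.
Proof. exact: (@rpredZ A A^o I a x). Qed.

End Ideal.

(** * Extension and contraction of ideals under localization *)

Section Localize.
Variables (A : comPzRingType) (P : prime_ideal A).

Lemma fracD (a b : A) (s t : denom P) :
  frac a s + frac b t = frac (a * den_val t + b * den_val s) (denomM s t).
Proof. exact: loc_addE. Qed.

Lemma fracM (a b : A) (s t : denom P) :
  frac a s * frac b t = frac (a * b) (denomM s t).
Proof. exact: loc_mulE. Qed.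

Lemma frac0 (s : denom P) : frac 0 s = 0.
Proof. by apply/frac_eq; exists s; rewrite !mul0r subrr mulr0. Qed.

Lemma to_loc_is_zmod : zmod_morphism (@to_loc A P).
Proof.
move=> a b; rewrite /to_loc -[- frac b _]/(loc_opp (frac b _)) loc_oppE fracD.
apply/frac_eq; exists (denom1 P) => /=; ring.
Qed.

Lemma to_loc_is_monoid : monoid_morphism (@to_loc A P).
Proof.
split=> [//|a b]; rewrite /to_loc fracM.
apply/frac_eq; exists (denom1 P) => /=; ring.
Qed.

HB.instance Definition _ :=
  GRing.isZmodMorphism.Build A (loc P) (@to_loc A P) to_loc_is_zmod.
HB.instance Definition _ :=
  GRing.isMonoidMorphism.Build A (loc P) (@to_loc A P) to_loc_is_monoid.

Lemma frac_split (a : A) (s : denom P) : frac a s = frac 1 s * to_loc P a.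
Proof. by rewrite fracM; apply/frac_eq; exists s => /=; ring. Qed.

Lemma den_frac (a : A) (s : denom P) :
  to_loc P (den_val s) * frac a s = to_loc P a.
Proof. by rewrite fracM; apply/frac_eq; exists s => /=; ring. Qed.

Lemma den_unit (s : denom P) : frac 1 s * to_loc P (den_val s) = 1.
Proof. by rewrite mulrC den_frac rmorph1. Qed.

Lemma extend_locP (I : submodClosed A^o) (x : loc P) :
  x \in extend_ideal (@to_loc A P) I <->
  exists (a : A) (s : denom P), a \in I /\ x = frac a s.
Proof.
split.
  pose Y (x : (loc P)^o) := exists (a : A) (s : denom P), a \in I /\ x = frac a s.
  apply: (span_ind (Y := Y)).
  - by exists 0, (denom1 P); split; [apply: rpred0 | rewrite frac0].
  - move=> r u v [a [s [Ia ->]]] [b [t [Ib ->]]].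
    have [g [w ->]] := frac_surj r.
    rewrite /Y; exists (g * a * den_val t + b * (den_val w * den_val s)).
    exists (denomM (denomM w s) t); split.
      rewrite mulrAC [b * _]mulrC.
      by apply: idealD; apply: idealM.
    by rewrite -[_ *: _]/(_ * _) fracM fracD.
  - by move=> y [a Ia ->]; exists a, (denom1 P).
move=> [a [s [Ia ->]]]; rewrite frac_split.
by apply: idealM; apply: span_gen; exists a.
Qed.

(** Saturated ideals are the contractions of their extensions, so strict inclusions between them
    persist in the localization. *)
Definition saturated (I : submodClosed A^o) : Prop :=
  forall s a : A, s \notin P -> s * a \in I -> a \in I.

Lemma prime_saturated (Q : prime_ideal A) : {subset Q <= P} -> saturated Q.
Proof.
move=> QP s a sP /(primeP Q).2 [/QP sP'|//]; by rewrite sP' in sP.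
Qed.

Lemma frac_extend (I : submodClosed A^o) (a : A) (s : denom P) :
  saturated I -> frac a s \in extend_ideal (@to_loc A P) I <-> a \in I.
Proof.
move=> sI; split=> [/extend_locP[b [t [Ib]]]|Ia]; last first.
  by apply/extend_locP; exists a, s.
move=> /frac_eq[u E]; apply: (sI (den_val (denomM u t))).
  exact: den_notin.
have -> : den_val (denomM u t) * a = (den_val u * den_val s) * b.
  by apply/eqP; rewrite -subr_eq0 -E /=; apply/eqP; ring.
exact: idealM.
Qed.

Lemma extend_strict (I J : submodClosed A^o) :
  saturated I -> saturated J -> strict_sub I J ->
  strict_sub (extend_ideal (@to_loc A P) I) (extend_ideal (@to_loc A P) J).
Proof.
move=> sI sJ [IJ nJI]; split.
  by move=> x /extend_locP[a [s [/IJ Ja ->]]]; apply/extend_locP; exists a, s.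
move=> H; apply: nJI => a Ja; apply/(frac_extend a (denom1 P) sI)/H.
exact/frac_extend.
Qed.

Lemma extend_prime (Q : prime_ideal A) :
  {subset Q <= P} -> is_prime (extend_ideal (@to_loc A P) Q).
Proof.
move=> QP; have sQ := prime_saturated QP; split.
  apply/negP; rewrite -[1]/(frac 1 (denom1 P)) => /(frac_extend _ _ sQ).
  by apply/negP; case: (primeP Q).
move=> x y; have [a [s ->]] := frac_surj x; have [b [t ->]] := frac_surj y.
rewrite fracM => /(frac_extend _ _ sQ) /(primeP Q).2.
by case=> H; [left|right]; apply/frac_extend.
Qed.

(** The preimage is already an ideal, by [contract_locP]; [span] only packages it as a
    [submodClosed]. *)
Definition contract_loc (J : submodClosed (loc P)^o) : submodClosed A^o :=
  span (fun a : A^o => to_loc P a \in J).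

Lemma contract_locP (J : submodClosed (loc P)^o) (a : A) :
  a \in contract_loc J <-> to_loc P a \in J.
Proof.
apply: (in_span_closed (X := fun a : A^o => to_loc P a \in J)).
  by rewrite rmorph0; apply: ideal0.
move=> r u v Ju Jv; rewrite rmorphD rmorphM.
by apply: idealD => //; apply: idealM.
Qed.

Lemma frac_contract (J : submodClosed (loc P)^o) (a : A) (s : denom P) :
  frac a s \in J <-> a \in contract_loc J.
Proof.
rewrite contract_locP; split=> H; [rewrite -(den_frac a s) | rewrite frac_split];
  exact: idealM.
Qed.

Lemma contract_strict (I J : submodClosed (loc P)^o) :
  strict_sub I J -> strict_sub (contract_loc I) (contract_loc J).
Proof.
move=> [IJ nJI]; split=> [a /contract_locP/IJ ?|H]; first exact/contract_locP.
apply: nJI => x; have [a [s ->]] := frac_surj x.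
by move=> /frac_contract/H ?; apply/frac_contract.
Qed.

Lemma contract_prime (J : prime_ideal (loc P)) : is_prime (contract_loc J).
Proof.
split; first by apply/negP => /contract_locP; rewrite rmorph1; apply/negP; case: (primeP J).
move=> x y /contract_locP; rewrite rmorphM => /(primeP J).2.
by case=> H; [left|right]; apply/contract_locP.
Qed.

Lemma krull_dim_loc (n : nat) :
  (exists Q : nat -> prime_ideal A, (forall i, (i <= n)%N -> {subset Q i <= P}) /\
     forall i, (i < n)%N -> strict_sub (Q i) (Q i.+1)) ->
  (forall (m : nat) (Q : nat -> prime_ideal A),
     (forall i, (i < m)%N -> strict_sub (Q i) (Q i.+1)) -> (m <= n)%N) ->
  is_krull_dim (loc P) n.
Proof.
move=> [Q [QP HQ]] Hub; split; last first.
  move=> m J HJ; apply: (Hub m (fun i => PrimeIdeal (contract_prime (J i)))).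
  by move=> i im; apply/contract_strict/HJ.
(* Chains are indexed by all of nat, so the sequence is frozen after n to keep every member inside
   P. *)
pose Q' i := Q (minn i n).
have Q'P i : {subset Q' i <= P} by apply: QP; rewrite geq_minr.
exists (fun i => PrimeIdeal (extend_prime (@Q'P i))) => i im /=.
apply: extend_strict; try exact/prime_saturated/Q'P.
by rewrite /Q' (minn_idPl im) (minn_idPl (ltnW im)); apply: HQ.
Qed.

End Localize.

(** * Length of a localized quotient from k-linear coordinates *)

Section QuotientLength.
Variables (A : comPzRingType) (P : prime_ideal A) (I : submodClosed A^o).
Variables (k : fieldType) (str : {rmorphism k -> A}).
Variables (l : nat) (co : 'I_l -> A -> k).
Hypothesis co_linear : forall j m (c : 'I_m -> k) (a : 'I_m -> A),
  co j (\sum_i str (c i) * a i) = \sum_i c i * co j (a i).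
Hypothesis coP : forall x : A, x \in I <-> forall j, co j x = 0.

Let IP := extend_ideal (@to_loc A P) I.
Let v (a : A) : quotmod IP := qpi IP (to_loc P a).

Lemma qpi_locD (x y : A) : v (x + y) = v x + v y.
Proof. by rewrite /v rmorphD qpiD. Qed.

Lemma qpi_loc0 : v 0 = 0.
Proof. apply: (addrI (v 0)); rewrite addr0 -qpi_locD addr0. by []. Qed.

Lemma qpi_loc_sum m (c : 'I_m -> A) (a : 'I_m -> A) :
  v (\sum_i c i * a i) = \sum_i to_loc P (c i) *: v (a i).
Proof.
rewrite (big_morph v qpi_locD qpi_loc0); apply: eq_bigr => i _.
by rewrite /v rmorphM; apply/esym/qscale_pi.
Qed.

Lemma qpi_loc_eq0 (a : A) : a \in I -> v a = 0.
Proof.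
move=> Ia; rewrite -qpi_loc0; apply/qpi_eq; rewrite rmorph0 subr0.
by apply: span_gen; exists a.
Qed.

Lemma length_le (m : nat) (N : nat -> submodClosed (quotmod IP)) :
  (forall i, (i < m)%N -> strict_sub (N i) (N i.+1)) -> (m <= l)%N.
Proof.
move=> HN; rewrite leqNgt; apply/negP => lm.
(* Denominators are units in [loc P], so the new element of each step can be represented in A. *)
have /choice[a Ha] (i : 'I_m) : exists a, v a \in N i.+1 /\ v a \notin N i.
  have [_ /existsNP[y /not_implyP[Ny' /negP Ny]]] := HN i (ltn_ord i).
  have [x xy] := qpi_surj y; have [a [s xa]] := frac_surj x.
  have E : v a = to_loc P (den_val s) *: y.
    by rewrite xy xa /v -(den_frac a s); apply/esym/qscale_pi.
  have E' : y = frac 1 s *: v a by rewrite E scalerA den_unit scale1r.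
  exists a; split; first by rewrite E; apply: rpredZ.
  by apply: contra Ny => ?; rewrite E'; apply: rpredZ.
have [c [[i0 ci0] Hc]] := linear_dependence (fun i j => co j (a i)) lm.
have : v (\sum_i str (c i) * a i) = 0.
  by apply: qpi_loc_eq0; apply/coP => j; rewrite co_linear.
(* The last term with a non-zero coefficient is a combination of earlier ones, which all lie in
   [N i]; this contradicts the choice of [a i]. *)
rewrite qpi_loc_sum; case: (@arg_maxnP _ i0 (fun i => c i != 0) val ci0) => i ci imax.
rewrite (bigD1 i) //= => /eqP; rewrite addr_eq0 => /eqP E.
have := (Ha i).2; apply/negP; rewrite negbK.
have ui : to_loc P (str (c i)^-1) * to_loc P (str (c i)) = 1.
  by rewrite -!rmorphM mulVf // !rmorph1.
rewrite -[v (a i)]scale1r -ui -scalerA; apply: rpredZ; rewrite E.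
rewrite -scaleN1r; apply: rpredZ; apply: rpred_sum => j ji; have [cj0|cj0] := eqVneq (c j) 0.
  by rewrite cj0 !rmorph0 scale0r rpred0.
apply: rpredZ; apply: (sub_chain HN _ _ (Ha j).1); last exact: ltnW.
by rewrite ltn_neqAle ji; apply: imax.
Qed.

(** The coordinates give the upper bound through [length_le]; saturation carries the l strict steps
    above I over to the quotient. *)
Lemma length_loc_quotient (J : nat -> submodClosed A^o) :
  (forall i, (i <= l)%N -> saturated P (J i)) -> {subset I <= J 0} ->
  (forall i, (i < l)%N -> strict_sub (J i) (J i.+1)) ->
  is_length (quotmod IP) l.
Proof.
move=> sJ IJ HJ; split; last by move=> m N; apply: length_le.
pose X i (y : quotmod IP) := exists2 x, x \in extend_ideal (@to_loc A P) (J i) & y = qpi IP x.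
have XP i y : y \in span (X i) <-> X i y.
  apply: in_span_closed.
    exists 0; first exact: rpred0.
    by rewrite -[in RHS](rmorph0 (@to_loc A P)) -/(v 0) qpi_loc0.
  move=> r u w [x Jx ->] [x' Jx' ->]; exists (r *: (x : (loc P)^o) + x').
    by apply: rpredD => //; apply: rpredZ.
  by rewrite qpiD; congr (_ + _); apply: qscale_pi.
exists (fun i => span (X i)) => i il.
have [JJ nJJ] := extend_strict (sJ i (ltnW il)) (sJ i.+1 il) (HJ i il).
split=> [y /XP[x Jx ->]|H]; first by apply/XP; exists x => //; apply: JJ.
apply: nJJ => x Jx; have /XP[x' Jx'] : qpi IP x \in span (X i).
  by apply: H; apply/XP; exists x.
move=> /qpi_eq Ixx'; rewrite -[x](subrK x'); apply: idealD => //.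
have /extend_locP[a [s [Ia ->]]] := Ixx'; apply/extend_locP; exists a, s; split=> //.
exact: (sub_chain HJ (leq0n i) (ltnW il)) (IJ _ Ia).
Qed.

End QuotientLength.

(** * Independent monomials from a chain of primes *)

Section PrimeChain.
Variables (k : fieldType) (A : comPzRingType) (str : {rmorphism k -> A}).

Lemma sum_digits (V : nmodType) (N M : nat) (F : nat -> V) :
  \sum_(e < N * M) F e = \sum_(a < N) \sum_(b < M) F (a + N * b)%N.
Proof.
rewrite exchange_big /=; elim: M => [|M IH]; first by rewrite muln0 !big_ord0.
rewrite big_ord_recr /= -IH -!(big_mkord xpredT) mulnSr.
rewrite (big_cat_nat _ (n := N * M)) ?leq_addr //=; congr (_ + _).
rewrite -{1}[(N * M)%N]add0n big_addn [(N * M + N)%N]addnC addnK.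
by rewrite big_mkord.
Qed.

(* The monomial in x_j, ..., x_(j+m-1) whose exponents are the digits of e in
   base N. *)
Fixpoint digit_mono (x : nat -> A) (N m j e : nat) : A :=
  if m is m'.+1 then x j ^+ (e %% N) * digit_mono x N m' j.+1 (e %/ N) else 1.

Lemma str_in_ideal (J : submodClosed A^o) (a : k) :
  (1 : A) \notin J -> str a \in J -> a = 0.
Proof.
move=> J1 Ja; apply/eqP; apply: contraNT J1 => a0.
by rewrite -(rmorph1 str) -(mulVf a0) rmorphM; apply: idealM.
Qed.

(** Here [g] stands for combinations of digit monomials in the later variables, for which membership
    in Q' already forces vanishing. As x lies in Q', only [g 0] remains modulo Q'; once it is zero,
    primality of Q allows division by x. *)
Lemma prime_pow_indep (Q Q' : prime_ideal A) (x : A) :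
  {subset Q <= Q'} -> x \in Q' -> x \notin Q ->
  forall (R : nat) (g : nat -> A), (forall r, g r \in Q' -> g r = 0) ->
  \sum_(r < R) x ^+ r * g r \in Q -> forall r, (r < R)%N -> g r = 0.
Proof.
move=> QQ' Q'x /negP Qx; elim=> [//|R IH] g Hg.
rewrite big_ord_recl expr0 mul1r.
have -> : \sum_(i < R) x ^+ (lift ord0 i) * g (lift ord0 i) =
    x * \sum_(i < R) x ^+ i * g i.+1.
  by rewrite mulr_sumr; apply: eq_bigr => i _; rewrite exprS mulrA.
set y := \sum_(i < R) _ => H; have g0 : g 0 = 0.
  apply: Hg; rewrite -[g 0](addrK (x * y)); apply: idealD; first exact: QQ'.
  by rewrite mulrC -mulNr; apply: idealM.
move: H; rewrite g0 add0r => /(primeP Q).2[/Qx //|Qy] [//|r] rR.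
apply: (IH (fun r => g r.+1)) => // r0; exact: Hg.
Qed.

(* If a combination of these monomials lies in Q j, one may divide by the
   lowest power of x j that occurs in it, since x j is not in Q j; as x j lies in
   the next prime, so does the coefficient of that power. *)
Lemma digit_mono_indep (Q : nat -> prime_ideal A) (x : nat -> A) (N m j : nat) :
  (0 < N)%N ->
  (forall i, (i < m)%N -> {subset Q (j + i)%N <= Q (j + i).+1}) ->
  (forall i, (i < m)%N -> x (j + i)%N \in Q (j + i).+1 /\ x (j + i)%N \notin Q (j + i)%N) ->
  forall c : nat -> k,
  \sum_(e < N ^ m) str (c e) * digit_mono x N m j e \in Q j ->
  forall e, (e < N ^ m)%N -> c e = 0.
Proof.
move=> N0; elim: m j => [|m IH] j QS Hx c.
  by rewrite expn0 big_ord1 mulr1 => /(str_in_ideal (primeP (Q j)).1) c0 [].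
pose g a := \sum_(b < N ^ m) str (c (a + N * b)%N) * digit_mono x N m j.+1 b.
(* With e = a + N b, the lowest digit a is the exponent of [x j] and b carries the later digits. *)
rewrite expnS (sum_digits N (N ^ m) (fun e => str (c e) * digit_mono x N m.+1 j e)) (eq_bigr (fun a : 'I_N => x j ^+ a * g a)); last first.
  move=> a _; rewrite mulr_sumr; apply: eq_bigr => b _ /=.
  rewrite [(a + _)%N]addnC [(N * b)%N]mulnC modnMDl modn_small // divnMDl // divn_small // addn0.
  by rewrite mulrCA.
have c0 a : (g a \in Q j.+1) -> forall b, (b < N ^ m)%N -> c (a + N * b)%N = 0.
  apply: (IH j.+1 _ _ (fun b => c (a + N * b)%N)) => i im; rewrite addSnnS.
    exact: QS.
  exact: Hx.
have := Hx 0 isT; have := QS 0 isT; rewrite !addn0 => QQ' [Q'x Qx].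
move=> /(prime_pow_indep QQ' Q'x Qx) H e eN.
have {}H a : (a < N)%N -> g a = 0.
  apply: H => r Qr; rewrite /g big1 // => b _.
  by rewrite (c0 r) ?rmorph0 ?mul0r.
rewrite (divn_eq e N) addnC mulnC; apply: c0.
  by rewrite H ?ideal0 ?ltn_pmod.
by rewrite ltn_divLR // mulnC.
Qed.

End PrimeChain.

(* [bal] is the semigroup of exponents of the monomials of A. *)
Record monomial_algebra (k : fieldType) (n : nat) (bal : pred (multinom n))
    (A : comPzRingType) := MonomialAlgebra {
  ma_str : {rmorphism k -> A};
  ma_emb :> {rmorphism A -> mpoly n k};
  ma_inj : injective ma_emb;
  ma_embC : forall a, ma_emb (ma_str a) = mpolyC n a;
  ma_bal : forall x m, (ma_emb x)@_m != 0 -> bal m;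
  ma_mon : forall m, bal m -> exists x, ma_emb x = mpolyX k m }.

Lemma mcoeffM_neq0 (k : fieldType) (n : nat) (p q : mpoly n k) m :
  (p * q)@_m != 0 ->
  exists m1 m2, [/\ m = mnm_add m1 m2, p@_m1 != 0 & q@_m2 != 0].
Proof.
rewrite -mcoeff_msupp => /msuppM_le /allpairsP[[m1 m2] /= [+ + ->]].
by rewrite !mcoeff_msupp; exists m1, m2.
Qed.

(** * Bounding chains of primes by counting monomials *)

Section MonomialDimension.
Variables (k : fieldType) (n : nat) (bal : pred (multinom n)).
Variables (A : comPzRingType) (E : monomial_algebra k bal A).

Lemma ma_sum m (c : 'I_m -> k) (a : 'I_m -> A) (t : multinom n) :
  (E (\sum_i ma_str E (c i) * a i))@_t = \sum_i c i * (E (a i))@_t.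
Proof.
rewrite rmorph_sum raddf_sum; apply: eq_bigr => i _.
by rewrite rmorphM /= ma_embC mcoeffCM.
Qed.

Lemma ma_coeff_sum (N : nat) (y : nat -> A) (t : multinom n) :
  (E (\sum_(i < N) y i))@_t = \sum_(i < N) (E (y i))@_t.
Proof. by rewrite rmorph_sum raddf_sum. Qed.

Definition deg_le (t : nat) (x : A) : Prop :=
  forall m, (E x)@_m != 0 -> (mdeg m <= t)%N.

Lemma deg_leW s t x : (s <= t)%N -> deg_le s x -> deg_le t x.
Proof. by move=> st H m /H ms; apply: leq_trans st. Qed.

Lemma deg_le1 : deg_le 0 1.
Proof.
move=> m; rewrite rmorph1 -[1]/(mpolyC n 1) mcoeffC mul1r.
by have [->|_] := eqVneq m mnm0; rewrite ?mdeg0 ?eqxx.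
Qed.

Lemma deg_leM s t x y : deg_le s x -> deg_le t y -> deg_le (s + t) (x * y).
Proof.
move=> Hx Hy m; rewrite rmorphM => /mcoeffM_neq0[m1 [m2 [-> /Hx ? /Hy ?]]].
by rewrite mdegD leq_add.
Qed.

Lemma deg_leX s x e : deg_le s x -> deg_le (e * s) (x ^+ e).
Proof.
move=> Hx; elim: e => [|e IH]; first exact: deg_le1.
by rewrite exprS mulSn; apply: deg_leM.
Qed.

Lemma deg_le_ex x : exists t, deg_le t x.
Proof.
exists (\max_(m <- msupp (E x)) mdeg m) => m.
by rewrite -mcoeff_msupp => Hm; apply: leq_bigmax_seq.
Qed.

Lemma deg_le_digit_mono x N m j e D : (0 < N)%N ->
  (forall i, (i < m)%N -> deg_le D (x (j + i)%N)) ->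
  deg_le (m * (N * D)) (digit_mono x N m j e).
Proof.
move=> N0; elim: m j e => [|m IH] j e H /=; first exact: deg_le1.
rewrite mulSn; apply: deg_leM.
  apply: (@deg_leW (e %% N * D)); first by rewrite leq_mul // ltnW ?ltn_pmod.
  by apply: deg_leX; rewrite -[j]addn0; apply: H.
by apply: IH => i im; rewrite addSnnS; apply: H.
Qed.

Lemma monomial_prime_chain (L m : nat) (Q : nat -> prime_ideal A) :
  (forall t, exists l (mm : 'I_l -> multinom n), (l <= t.+1 ^ L)%N /\
     forall m, bal m -> (mdeg m <= t)%N -> exists i, m = mm i) ->
  (forall i, (i < m)%N -> strict_sub (Q i) (Q i.+1)) -> (m <= L)%N.
Proof.
move=> cover HQ; rewrite leqNgt; apply/negP => Lm.
have {Lm HQ} [Q' HQ'] : exists Q : nat -> prime_ideal A,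
    forall i, (i < L.+1)%N -> strict_sub (Q i) (Q i.+1).
  by exists Q => i iL; apply: HQ; apply: leq_trans Lm.
have /choice[x Hx] (i : nat) : exists x, (i < L.+1)%N -> x \in Q' i.+1 /\ x \notin Q' i.
  have [iL|_] := ltnP i L.+1; last by exists 0.
  have [_ /existsNP[y /not_implyP[? /negP ?]]] := HQ' i iL.
  by exists y.
have [D HD] : exists D, forall i, (i < L.+1)%N -> deg_le D (x i).
  have /choice[D HD] i := deg_le_ex (x i).
  exists (\max_(i < L.+1) D i) => i iL; apply: deg_leW (HD i).
  exact: (leq_bigmax (Ordinal iL)).
(* C is chosen so that t + 1 <= N C below; then N > C^L gives (t + 1)^L <= N^L C^L < N^(L+1), fewer
   coefficients than digit monomials. *)
pose C := (L.+1 * D).+1; have [N CN] : exists N, (C ^ L < N)%N.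
  by exists (C ^ L).+1.
have N0 : (0 < N)%N by apply: leq_ltn_trans CN.
pose t := (L.+1 * (N * D))%N.
have [l [mm [lt Hmm]]] := cover t.
have tNC : (t.+1 <= N * C)%N by rewrite /t /C; nia.
have lN : (l < N ^ L.+1)%N.
  apply: leq_ltn_trans lt _; apply: (@leq_ltn_trans ((N * C) ^ L)).
    by case: (L) => [|L'] //; rewrite leq_exp2r.
  by rewrite expnMn expnSr ltn_pmul2l ?expn_gt0 ?N0.
pose w := digit_mono x N L.+1 0.
have [a [[i ai] Ha]] := linear_dependence
  (fun (i : 'I_(N ^ L.+1)) j => (E (w i))@_(mm j)) lN.
pose c e := if insub e is Some i then a i else 0.
have cE (i' : 'I_(N ^ L.+1)) : c i' = a i' by rewrite /c valK.
suff ci : c i = 0 by rewrite -cE ci eqxx in ai.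
(* The dependent combination has no non-zero coefficient, so it is zero by injectivity and lies in
   [Q' 0]. *)
apply: (@digit_mono_indep k A (ma_str E) Q' x N L.+1 0 _ _ _ c) => //.
  by move=> j jL; case: (HQ' _ jL).
rewrite (_ : \sum_(e < _) _ = 0) ?ideal0 //; apply: (@ma_inj _ _ _ _ E).
rewrite rmorph0; apply/mpolyP => m'; rewrite mcoeff0.
rewrite (ma_sum (fun i => c i) (fun i => w i)).
have [H|] := pselect (forall i : 'I_(N ^ L.+1), (E (w i))@_m' = 0).
  by rewrite big1 // => j _; rewrite H mulr0.
move=> /existsNP[i' /eqP Hm'].
have [|j ->] := Hmm m' (ma_bal Hm').
  by apply: (@deg_le_digit_mono x N L.+1 0 i' D) Hm' => // ? ?; apply: HD.
by rewrite -[RHS](Ha j); apply: eq_bigr => ? _; rewrite cE.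
Qed.

End MonomialDimension.

(** * Monomial ideals: primes, saturation, lengths *)

Section MonomialIdeals.
Variables (k : fieldType) (n : nat) (bal : pred (multinom n)).
Variables (A : comPzRingType) (E : monomial_algebra k bal A).
Local Notation mX := (@mpolyX n k).

(** U collects the exponents surviving modulo a monomial ideal. Closure under divisors in the
    semigroup makes vanishing of the coefficients on U stable under multiplication by A. *)
Definition down_closed (U : pred (multinom n)) : Prop :=
  forall m1 m2, bal m1 -> bal m2 -> U (mnm_add m1 m2) -> U m2.

Definition mono_ideal (U : pred (multinom n)) : submodClosed A^o :=
  span (fun x : A^o => forall m, U m -> (E x)@_m = 0).

Lemma bal0 : bal (@mnm0 n).
Proof.
apply: (@ma_bal _ _ _ _ E 1).
by rewrite rmorph1 -[1]/(mpolyC n 1) mcoeffC eqxx mulr1 oner_neq0.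
Qed.

Lemma balD m1 m2 : bal m1 -> bal m2 -> bal (mnm_add m1 m2).
Proof.
move=> /(ma_mon E)[x Ex] /(ma_mon E)[y Ey].
apply: (@ma_bal _ _ _ _ E (x * y)).
by rewrite rmorphM Ex Ey -mpolyXD mcoeffX eqxx oner_neq0.
Qed.

Lemma balM m e : bal m -> bal (mnm_muln m e).
Proof.
move=> bm; elim: e => [|e IH]; first by rewrite mulm0n bal0.
by rewrite mulmS balD.
Qed.

Lemma mono_idealP (U : pred (multinom n)) (x : A) : down_closed U ->
  x \in mono_ideal U <-> forall m, U m -> (E x)@_m = 0.
Proof.
move=> dU; apply: (in_span_closed (X := fun x : A^o => forall m, U m -> (E x)@_m = 0)).
  by move=> m _; rewrite rmorph0 mcoeff0.
move=> a u v Hu Hv m Um; rewrite rmorphD mcoeffD (Hv m Um) addr0.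
apply/eqP/negPn/negP; rewrite -[a *: u]/(a * u) rmorphM.
move=> /mcoeffM_neq0[m1 [m2 [mE H1 H2]]].
by case/eqP: (H2); apply: Hu; apply: dU (ma_bal H1) (ma_bal H2) _; rewrite -mE.
Qed.

Definition avoids (V : pred 'I_n) (m : multinom n) : bool :=
  [forall i, V i ==> (m i == 0%N)].

Lemma avoidsP (V : pred 'I_n) (m : multinom n) :
  reflect (forall i, V i -> m i = 0%N) (avoids V m).
Proof.
apply: (iffP forallP) => H i; first by move=> Vi; apply/eqP; have /implyP := H i; apply.
by apply/implyP => /H ->.
Qed.

Lemma avoids_down (V : pred 'I_n) : down_closed (avoids V).
Proof.
move=> m1 m2 _ _ /avoidsP H; apply/avoidsP => i /H; rewrite mnmDE => /eqP.
by rewrite addn_eq0 => /andP[_ /eqP].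
Qed.

Definition kill (V : pred 'I_n) : mpoly n k -> mpoly n k :=
  mmap (@mpolyC n k) (fun i => if V i then 0 else mX (mnm1 i)).

HB.instance Definition _ V := GRing.RMorphism.on (kill V).

Lemma mcoeff_kill (V : pred 'I_n) (q : mpoly n k) m :
  (kill V q)@_m = if avoids V m then q@_m else 0.
Proof.
have killX m' : mmap1 (fun i => if V i then 0 else mX (mnm1 i)) m' =
    if avoids V m' then mX m' else 0.
  rewrite /mmap1; case: ifP => [/avoidsP H|/negbT].
    rewrite -[RHS]/(@mpolyX n k m') [RHS]mpolyXE_id; apply: eq_bigr => i _.
    by case: ifP => // /H ->; rewrite !expr0.
  rewrite negb_forall => /existsP[i]; rewrite negb_imply => /andP[Vi mi].
  by rewrite (bigD1 i) //= Vi expr0n (negbTE mi) mul0r.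
rewrite /kill /mmap raddf_sum /=.
under eq_bigr => m' _ do rewrite mcoeffCM killX.
rewrite [in RHS](mpolyE q) raddf_sum /= -mulrb -sumrMnl.
apply: eq_bigr => m' _; rewrite mcoeffZ mulrb.
case: (eqVneq m' m) => [->|m'm]; first by case: ifP => _; rewrite ?mcoeff0 ?mulr0.
have X0 : (mX m')@_m = 0 by rewrite mcoeffX (negbTE m'm).
by rewrite X0 mulr0 if_same; case: ifP => _; rewrite ?X0 ?mcoeff0 mulr0.
Qed.

Lemma avoids_idealP V (x : A) : x \in mono_ideal (avoids V) <-> kill V (E x) = 0.
Proof.
rewrite (mono_idealP _ (@avoids_down V)); split=> H.
  by apply/mpolyP => m; rewrite mcoeff_kill mcoeff0; case: ifP => // /H.
by move=> m Vm; have := mcoeff_kill V (E x) m; rewrite H mcoeff0 Vm.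
Qed.

(** The ideal is the kernel of [kill V] after E, a ring morphism into a domain. *)
Lemma avoids_prime V : is_prime (mono_ideal (avoids V)).
Proof.
split; first by apply/negP => /avoids_idealP/eqP; rewrite !rmorph1 oner_eq0.
move=> x y /avoids_idealP/eqP; rewrite !rmorphM mulf_eq0.
by case/orP => /eqP H; [left|right]; apply/avoids_idealP.
Qed.

Definition avoids_ideal V := PrimeIdeal (@avoids_prime V).
Definition irrelevant : prime_ideal A := avoids_ideal predT.

Lemma irrelevantP (x : A) : x \in irrelevant <-> (E x)@_(@mnm0 n) = 0.
Proof.
rewrite (mono_idealP _ (@avoids_down _)); split=> [H|H m /avoidsP m0].
  by apply: H; apply/avoidsP => i _; rewrite mnm0E.
by rewrite (_ : m = @mnm0 n) //; apply/mnmP => i; rewrite m0 // mnm0E.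
Qed.

Lemma ma_coeff0 (x : A) : x - ma_str E ((E x)@_(@mnm0 n)) \in irrelevant.
Proof.
by apply/irrelevantP; rewrite rmorphB ma_embC mcoeffB mcoeffC eqxx mulr1 subrr.
Qed.

Lemma irrelevant_maximal : is_maximal irrelevant.
Proof.
split; first by case: (primeP irrelevant).
move=> J PJ J1 x Jx; apply/irrelevantP; apply: (str_in_ideal (str := ma_str E) J1).
have -> : ma_str E (E x)@_(@mnm0 n) = x + (-1) * (x - ma_str E (E x)@_(@mnm0 n)) by ring.
by apply: idealD => //; apply: idealM; apply/PJ/ma_coeff0.
Qed.

(** If s has constant term s0, the coefficient of s a at m is s0 a_m plus terms in a_m2 for proper
    divisors m2 of m. These vanish by induction on the degree, and s0 is non-zero. *)
Lemma mono_ideal_saturated U : down_closed U -> saturated irrelevant (mono_ideal U).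
Proof.
move=> dU s a /negP sP /(mono_idealP _ dU) sa; apply/mono_idealP => // m.
have s0 : (E s)@_(@mnm0 n) != 0 by apply/eqP => /irrelevantP.
have [d] := ubnP (mdeg m); elim: d m => [//|d IH] m; rewrite ltnS => md Um.
have := sa m Um; rewrite -[s](subrK (ma_str E (E s)@_(@mnm0 n))) mulrDl.
rewrite rmorphD mcoeffD rmorphM [E (ma_str E _ * a)]rmorphM ma_embC mcoeffCM.
set s' := s - _; rewrite [X in X + _](_ : _ = 0).
  by move/eqP; rewrite add0r mulf_eq0 (negbTE s0) => /eqP.
apply/eqP/negPn/negP => /mcoeffM_neq0[m1 [m2 [mE H1 H2]]].
have m10 : (0 < mdeg m1)%N.
  rewrite lt0n mdeg_eq0; apply: contraNneq H1 => ->.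
  by apply/eqP/irrelevantP/ma_coeff0.
case/eqP: (H2); apply: IH.
  by apply: leq_trans md; rewrite mE mdegD -[X in (X < _)%N]add0n ltn_add2r.
by apply: dU (ma_bal H1) (ma_bal H2) _; rewrite -mE.
Qed.

(** When S is listed by decreasing degree, every tail is down-closed, since a proper divisor has
    smaller degree and comes later. The ideals of the tails form a chain that gains one monomial at
    each step. *)
Lemma mono_length (S : seq (multinom n)) (I : submodClosed A^o) :
  uniq S -> all bal S -> down_closed (mem S) -> I =i mono_ideal (mem S) ->
  is_length (quotmod (extend_ideal (@to_loc A irrelevant) I)) (size S).
Proof.
move=> uS bS dS IS; pose r (m1 m2 : multinom n) := (mdeg m2 <= mdeg m1)%N.
have r_tr : transitive r by move=> a b c ba ac; apply: leq_trans ac ba.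
pose T := sort r S; have TS : T =i S := mem_sort r S.
have pT i : pairwise r (take i T ++ drop i T).
  rewrite cat_take_drop -sorted_pairwise //; apply: sort_sorted => a b.
  exact: leq_total.
have dT i : down_closed (mem (drop i T)).
  move=> m1 m2 b1 b2 /= H; have : m2 \in take i T ++ drop i T.
    rewrite cat_take_drop TS; apply: (dS m1) => //=.
    by rewrite -TS; apply: mem_drop H.
  rewrite mem_cat => /orP[m2T|//]; have := pT i; rewrite pairwise_cat.
  case/andP => /allrelP /(_ _ _ m2T H); rewrite /r mdegD.
  rewrite -[X in (_ <= X)%N]add0n leq_add2r leqn0 mdeg_eq0 => /eqP m10 _.
  by move: H; rewrite m10 add0m.
have sT : size T = size S by rewrite size_sort.
apply: (@length_loc_quotient _ _ _ k (ma_str E) (size S)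
  (fun j x => (E x)@_(nth (@mnm0 n) S j)) _ _
  (fun i => mono_ideal (mem (drop i T)))).
- by move=> j m c a; rewrite ma_sum.
- move=> x; rewrite IS mono_idealP //; split=> H.
    by move=> j; apply: H; apply: mem_nth.
  move=> m /= mS; have jS : (index m S < size S)%N by rewrite index_mem.
  by have := H (Ordinal jS); rewrite /= nth_index.
- by move=> i _; apply: mono_ideal_saturated.
- move=> x; rewrite IS => /(mono_idealP _ dS) H; apply/mono_idealP => // m.
  by rewrite /= drop0 TS => /H.
move=> i iS; have dE := drop_nth (@mnm0 n) (s := T) (n := i).
rewrite sT in dE; have {}dE := dE iS; set m := nth _ T i in dE.
have bm : bal m.
  by apply: (allP bS); rewrite -TS mem_nth // sT.
split=> [x /(mono_idealP _ (dT i)) H|H].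
  by apply/mono_idealP => // m' /= m'T; apply: H; rewrite /= dE inE m'T orbT.
have [x Ex] := ma_mon E bm.
have /H /(mono_idealP _ (dT i)) /(_ m) : x \in mono_ideal (mem (drop i.+1 T)).
  apply/mono_idealP => // m' /= m'T; rewrite Ex mcoeffX.
  case: eqVneq => // mm'; have : uniq (drop i T) by rewrite drop_uniq ?sort_uniq.
  by rewrite dE /= mm' m'T.
rewrite /= dE inE eqxx /= => /(_ isT)/eqP.
by rewrite Ex mcoeffX eqxx oner_eq0.
Qed.

Section Frobenius.
Variables (p e : nat).
Hypothesis chp : p \in [pchar k].
Let q := (p ^ e)%N.

Definition frob_mult (m : multinom n) : Prop := exists m1 m2,
  [/\ bal m1, bal m2, m1 != @mnm0 n & m = mnm_add (mnm_muln m1 q) m2].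

(** In characteristic p the q-th power is additive, so y^q is a combination of monomials X^(q m)
    with m in the support of y. Conversely, each monomial of x lifts to A as a multiple of a q-th
    power, its scalar staying outside. *)
Lemma frobenius_irrelevantP (x : A) :
  x \in frobenius_power q irrelevant <->
  forall m, (E x)@_m != 0 -> frob_mult m.
Proof.
split; last first.
  move=> Hx; have /choice[a Ha] m : exists a, bal m -> E a = mX m.
    by case: (boolP (bal m)) => [/(ma_mon E)[a]|]; [exists a | exists 0].
  have -> : x = \sum_(m <- msupp (E x)) ma_str E (E x)@_m * a m.
    apply: (@ma_inj _ _ _ _ E); rewrite [LHS]mpolyE rmorph_sum /=.
    rewrite big_seq [RHS]big_seq; apply: eq_bigr => m.
    rewrite mcoeff_msupp => Hm; rewrite rmorphM /= ma_embC Ha ?(ma_bal Hm) //.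
    by rewrite mul_mpolyC.
  rewrite big_seq; apply: (rpred_sum (V := A^o)) => m.
  rewrite mcoeff_msupp => Hm; apply: idealM.
  have [m1 [m2 [b1 b2 m10 mE]]] := Hx m Hm.
  have -> : a m = a m2 * a m1 ^+ q.
    apply: (@ma_inj _ _ _ _ E); rewrite rmorphM rmorphXn /= !Ha ?(ma_bal Hm) //.
    by rewrite mE mpolyXD mpolyXn mulrC.
  apply: idealM; apply: span_gen; exists (a m1) => //.
  by apply/irrelevantP; rewrite Ha // mcoeffX (negbTE m10).
apply: (span_ind (Y := fun x : A^o => forall m, (E x)@_m != 0 -> frob_mult m)).
- by move=> m; rewrite rmorph0 mcoeff0 eqxx.
- move=> a u v Hu Hv m; rewrite rmorphD mcoeffD.
  have [E0|Em] := eqVneq (E (a *: u))@_m 0; first by rewrite E0 add0r; apply: Hv.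
  move: Em; rewrite -[a *: u]/(a * u) rmorphM => /mcoeffM_neq0[m1 [m2 [mE H1 H2]]] _.
  have [m3 [m4 [b3 b4 m30 m2E]]] := Hu _ H2.
  exists m3, (mnm_add m1 m4); split=> //; first by rewrite balD ?(ma_bal H1).
  by rewrite mE m2E; apply/mnmP => i; rewrite !mnmDE; lia.
move=> _ [y Py ->] m; rewrite rmorphXn /=.
have chM : p \in [pchar (mpoly n k)] by apply: (rmorph_pchar (@mpolyC n k)).
have qn : [pchar (mpoly n k)].-nat q by rewrite pnatX pnatE ?(pcharf_prime chp) ?chM.
rewrite {1}[E y]mpolyE.
have -> (s : seq (multinom n)) : (\sum_(m <- s) (E y)@_m *: mX m) ^+ q =
    \sum_(m <- s) ((E y)@_m ^+ q) *: mX (mnm_muln m q).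
  have q0 : (0 < q)%N by rewrite expn_gt0 (prime_gt0 (pcharf_prime chp)).
  elim: s => [|m' s IH]; first by rewrite !big_nil expr0n gtn_eqF.
  by rewrite !big_cons exprDn_pchar // IH exprZn mpolyXn.
rewrite raddf_sum /= => /eqP H.
have [m' m'y] : exists2 m', m' \in msupp (E y) & mnm_muln m' q = m.
  apply: contrapT => H'; apply: H; rewrite big_seq big1 // => m' m'y.
  rewrite mcoeffZ mcoeffX; case: eqVneq => [E'|_]; last by rewrite mulr0.
  by case: H'; exists m'.
move=> <-; move: m'y; rewrite mcoeff_msupp => m'y.
exists m', (@mnm0 n); split; rewrite ?bal0 ?(ma_bal m'y) ?addm0 //.
by apply: contraNneq m'y => ->; apply/eqP/irrelevantP.
Qed.

Lemma frobenius_length (S : seq (multinom n)) :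
  uniq S -> (forall m, m \in S <-> bal m /\ ~ frob_mult m) ->
  is_length (quotmod (extend_ideal (@to_loc A irrelevant)
    (frobenius_power q irrelevant))) (size S).
Proof.
move=> uS HS; have dS : down_closed (mem S).
  move=> m1 m2 b1 b2 /HS[_ H]; apply/HS; split=> // -[m3 [m4 [b3 b4 m30 m2E]]].
  apply: H; exists m3, (mnm_add m1 m4); split; rewrite ?balD //.
  by rewrite m2E; apply/mnmP => i; rewrite !mnmDE; lia.
apply: mono_length => //; first by apply/allP => m /HS[].
move=> x; apply/idP/idP => [/frobenius_irrelevantP Hx|].
  apply/mono_idealP => // m /HS[bm H]; apply/eqP/negPn/negP => /Hx.
  exact: H.
move/(mono_idealP _ dS) => Hx; apply/frobenius_irrelevantP => m Hm.
apply: contrapT => H; have /Hx/eqP : mem S m by apply/HS; rewrite (ma_bal Hm).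
by rewrite (negbTE Hm).
Qed.

End Frobenius.

(** [V j] lists the variables killed at stage j; the monomial m lies in the (j+1)-st prime but not
    in the j-th. *)
Lemma monomial_krull_dim (L : nat) (V : nat -> pred 'I_n) :
  (forall t, exists l (mm : 'I_l -> multinom n), (l <= t.+1 ^ L)%N /\
     forall m, bal m -> (mdeg m <= t)%N -> exists i, m = mm i) ->
  (forall j i, V j i -> V j.+1 i) ->
  (forall j, (j < L)%N ->
     exists m, [/\ bal m, avoids (V j) m & ~~ avoids (V j.+1) m]) ->
  is_krull_dim (loc irrelevant) L.
Proof.
move=> cover VS Vm; apply: krull_dim_loc; last first.
  by move=> m Q; apply: (@monomial_prime_chain k n bal A E).
exists (fun j => avoids_ideal (V j)); split.
  move=> j _ x /(mono_idealP _ (@avoids_down _)) H; apply/irrelevantP.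
  by apply: H; apply/avoidsP => i _; rewrite mnm0E.
move=> j /Vm[m [bm Vj Vj1]]; have [x Ex] := ma_mon E bm; split.
  move=> y /(mono_idealP _ (@avoids_down _)) H.
  apply/(mono_idealP _ (@avoids_down _)) => m' /avoidsP Hm'.
  by apply: H; apply/avoidsP => i /VS; apply: Hm'.
have Hx : x \in avoids_ideal (V j.+1).
  apply/(mono_idealP _ (@avoids_down _)) => m' Hm'.
  by rewrite Ex mcoeffX; case: eqVneq => // mm'; rewrite mm' Hm' in Vj1.
move=> /(_ x Hx)/(mono_idealP _ (@avoids_down _))/(_ m Vj)/eqP.
by rewrite Ex mcoeffX eqxx oner_eq0.
Qed.

End MonomialIdeals.

(** * Embedding the Segre product in a polynomial ring *)

Section SegreEmbedding.
Variables (k : fieldType) (c d : nat).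
Local Notation B := (poly_graded k c).
Local Notation C := (poly_graded k d).

Definition mnm_of n (f : 'I_n -> nat) : multinom n := Multinom [tuple f i | i < n].

Lemma mnm_ofE n (f : 'I_n -> nat) i : mnm_of f i = f i.
Proof. exact: mnmE. Qed.

Definition mnm_left (m : multinom (c + d)) : multinom c :=
  mnm_of (fun i => m (lshift d i)).
Definition mnm_right (m : multinom (c + d)) : multinom d :=
  mnm_of (fun i => m (rshift c i)).
Definition mnm_join (a : multinom c) (b : multinom d) : multinom (c + d) :=
  mnm_of (fun i => match split i with inl i => a i | inr j => b j end).
Definition balanced : pred (multinom (c + d)) :=
  fun m => mdeg (mnm_left m) == mdeg (mnm_right m).

Lemma mnm_join_l a b i : mnm_join a b (lshift d i) = a i.
Proof. by rewrite mnm_ofE (unsplitK (inl i)). Qed.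

Lemma mnm_join_r a b i : mnm_join a b (rshift c i) = b i.
Proof. by rewrite mnm_ofE (unsplitK (inr i)). Qed.

Lemma mnm_joinK m : mnm_join (mnm_left m) (mnm_right m) = m.
Proof.
apply/mnmP => i; case: (split_ordP i) => j ->.
  by rewrite mnm_join_l mnm_ofE.
by rewrite mnm_join_r mnm_ofE.
Qed.

Lemma mnm_left_join a b : mnm_left (mnm_join a b) = a.
Proof. by apply/mnmP => i; rewrite mnm_ofE mnm_join_l. Qed.

Lemma mnm_right_join a b : mnm_right (mnm_join a b) = b.
Proof. by apply/mnmP => i; rewrite mnm_ofE mnm_join_r. Qed.

Lemma mnm_joinD a b a' b' :
  mnm_add (mnm_join a b) (mnm_join a' b') = mnm_join (mnm_add a a') (mnm_add b b').
Proof.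
apply/mnmP => i; rewrite mnmDE; case: (split_ordP i) => j ->.
  by rewrite !mnm_join_l mnmDE.
by rewrite !mnm_join_r mnmDE.
Qed.

Lemma mdeg_split m : mdeg m = (mdeg (mnm_left m) + mdeg (mnm_right m))%N.
Proof.
by rewrite !mdegE big_split_ord /=; congr (_ + _)%N; apply: eq_bigr => i _; rewrite mnm_ofE.
Qed.

Definition inl_mpoly : mpoly c k -> mpoly (c + d) k :=
  mmap (@mpolyC (c + d) k) (fun i => mpolyX k (mnm1 (lshift d i))).
Definition inr_mpoly : mpoly d k -> mpoly (c + d) k :=
  mmap (@mpolyC (c + d) k) (fun i => mpolyX k (mnm1 (rshift c i))).
HB.instance Definition _ := GRing.RMorphism.on inl_mpoly.
HB.instance Definition _ := GRing.RMorphism.on inr_mpoly.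

Lemma inl_mpolyX a : inl_mpoly (mpolyX k a) = mpolyX k (mnm_join a (@mnm0 d)).
Proof.
rewrite /inl_mpoly mmapX /mmap1 mpolyXE_id big_split_ord /=.
rewrite [X in _ * X]big1 ?mulr1 => [|j _]; last by rewrite mnm_join_r mnm0E expr0.
by apply: eq_bigr => i _; rewrite mnm_join_l.
Qed.

Lemma inr_mpolyX b : inr_mpoly (mpolyX k b) = mpolyX k (mnm_join (@mnm0 c) b).
Proof.
rewrite /inr_mpoly mmapX /mmap1 mpolyXE_id big_split_ord /=.
rewrite [X in X * _]big1 ?mul1r => [|j _]; last by rewrite mnm_join_l mnm0E expr0.
by apply: eq_bigr => i _; rewrite mnm_join_r.
Qed.

Lemma inl_mpolyC a : inl_mpoly (mpolyC c a) = mpolyC (c + d) a.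
Proof. exact: mmapC. Qed.

Lemma inr_mpolyC a : inr_mpoly (mpolyC d a) = mpolyC (c + d) a.
Proof. exact: mmapC. Qed.

Lemma mp_compX n r (m : multinom n) : mdeg m = r -> mp_comp r (mpolyX k m).
Proof. by move=> <-; rewrite /mp_comp dhomogX. Qed.

Lemma homog_ind n r (Y : mpoly n k -> Prop) :
  Y 0 ->
  (forall a b b', mp_comp r b -> mp_comp r b' -> Y b -> Y b' -> Y (mpolyC n a * b + b')) ->
  (forall m, mdeg m = r -> Y (mpolyX k m)) ->
  forall b, mp_comp r b -> Y b.
Proof.
move=> Y0 YZD YX b /dhomogP Hb; rewrite (mpolyE b).
have : forall m, m \in msupp b -> mdeg m = r by move=> m /Hb.
elim: (msupp b) => [|m s IH] Hs; first by rewrite big_nil.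
(* Homogeneity of the partial sums is carried along because the linearity hypothesis on Y asks for
   it. *)
suff [] : mp_comp r (\sum_(m <- m :: s) b@_m *: mpolyX k m) /\
  Y (\sum_(m <- m :: s) b@_m *: mpolyX k m) by [].
have {}IH : mp_comp r (\sum_(m <- s) b@_m *: mpolyX k m) /\
   Y (\sum_(m <- s) b@_m *: mpolyX k m).
  have {}Hs m' : m' \in s -> mdeg m' = r by move=> m's; apply: Hs; rewrite inE m's orbT.
  split; last exact: IH.
  by rewrite big_seq; apply: rpred_sum => m' /Hs/mp_compX; apply: dhomogZ.
have dm : mdeg m = r by apply: Hs; rewrite mem_head.
rewrite big_cons -mul_mpolyC; split; first by apply: mp_compZD; [apply: mp_compX | case: IH].
by apply: YZD; [apply: mp_compX | case: IH | apply: YX | case: IH].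
Qed.

Definition seg_poly (n : nat) (b : B) (b' : C) : mpoly (c + d) k :=
  inl_mpoly b * inr_mpoly b'.

Lemma seg_poly_bilinear : bilinear_family (B := B) (C := C) seg_poly.
Proof.
split=> n a x y z _ _ _; rewrite /seg_poly rmorphD rmorphM /=.
  by rewrite inl_mpolyC mulrDl -mulrA mul_mpolyC.
by rewrite inr_mpolyC mulrDr mulrCA mul_mpolyC.
Qed.

Definition seg_emb (x : segre B C) : mpoly (c + d) k := seg_eval seg_poly x.

Lemma seg_emb_class s : seg_emb (seg_class s) = pt_eval seg_poly s.
Proof. exact/seg_evalE/seg_poly_bilinear. Qed.

Lemma seg_emb_is_zmod : zmod_morphism seg_emb.
Proof.
move=> x y; rewrite /seg_emb (seg_eval_add _ _ seg_poly_bilinear).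
by rewrite (seg_eval_opp _ seg_poly_bilinear).
Qed.

Lemma seg_emb_is_monoid : monoid_morphism seg_emb.
Proof.
split; first by rewrite seg_emb_class pt_eval1 /seg_poly !rmorph1 mulr1.
move=> x y; rewrite -[x]seg_reprK -[y]seg_reprK seg_classM !seg_emb_class.
rewrite /pt_eval big_allpairs_dep mulr_suml; apply: eq_bigr => s _.
rewrite mulr_sumr; apply: eq_bigr => t _.
by rewrite /seg_poly !rmorphM /= mulrACA.
Qed.

HB.instance Definition _ := GRing.isZmodMorphism.Build (segre B C)
  (mpoly (c + d) k) seg_emb seg_emb_is_zmod.
HB.instance Definition _ := GRing.isMonoidMorphism.Build (segre B C)
  (mpoly (c + d) k) seg_emb seg_emb_is_monoid.

Lemma seg_emb_str a : seg_emb (seg_str B C a) = mpolyC (c + d) a.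
Proof. by rewrite seg_emb_class pt_eval1 /seg_poly /= inl_mpolyC rmorph1 mulr1. Qed.

Lemma seg_poly_deg n b b' m : mp_comp n b -> mp_comp n b' ->
  (seg_poly n b b')@_m != 0 -> mdeg (mnm_left m) = n /\ mdeg (mnm_right m) = n.
Proof.
move=> Hb Hb' /mcoeffM_neq0[m1 [m2 [-> H1 H2]]].
have : mdeg (mnm_left m1) = n /\ mnm_right m1 = @mnm0 d.
  move: b Hb {H2} m1 H1; apply: homog_ind.
  - by move=> m1; rewrite rmorph0 mcoeff0 eqxx.
  - move=> a b1 b2 _ _ Y1 Y2 m1; rewrite rmorphD rmorphM /= inl_mpolyC mcoeffD mcoeffCM.
    have [E1|/Y1 //] := eqVneq (inl_mpoly b1)@_m1 0.
    by rewrite E1 mulr0 add0r; apply: Y2.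
  move=> a <- m1; rewrite inl_mpolyX mcoeffX.
  have [<- _|_] := eqVneq (mnm_join a (@mnm0 d)) m1; last by rewrite eqxx.
  by rewrite mnm_left_join mnm_right_join.
have : mdeg (mnm_right m2) = n /\ mnm_left m2 = @mnm0 c.
  move: b' Hb' {H1} m2 H2; apply: homog_ind.
  - by move=> m2; rewrite rmorph0 mcoeff0 eqxx.
  - move=> a b1 b2 _ _ Y1 Y2 m2; rewrite rmorphD rmorphM /= inr_mpolyC mcoeffD mcoeffCM.
    have [E1|/Y1 //] := eqVneq (inr_mpoly b1)@_m2 0.
    by rewrite E1 mulr0 add0r; apply: Y2.
  move=> a <- m2; rewrite inr_mpolyX mcoeffX.
  have [<- _|_] := eqVneq (mnm_join (@mnm0 c) a) m2; last by rewrite eqxx.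
  by rewrite mnm_left_join mnm_right_join.
move=> [r2 l2] [l1 r1]; rewrite -[m1]mnm_joinK -[m2]mnm_joinK mnm_joinD.
by rewrite mnm_left_join mnm_right_join !mdegD r1 l2 !mdeg0 addn0 add0n.
Qed.

Lemma pt_eval_deg (s : seq (pure_tensor B C)) m : (pt_eval seg_poly s)@_m != 0 ->
  exists2 t, t \in s & mdeg (mnm_left m) = pt_deg t /\ mdeg (mnm_right m) = pt_deg t.
Proof.
rewrite /pt_eval raddf_sum /= => /eqP H; apply: contrapT => H'; apply: H.
rewrite big_seq big1 // => t ts; apply/eqP/negPn/negP.
by move=> /(seg_poly_deg (pt_lP t) (pt_rP t)) Ht; apply: H'; exists t.
Qed.

Lemma seg_emb_balanced x m : (seg_emb x)@_m != 0 -> balanced m.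
Proof.
rewrite -[x]seg_reprK seg_emb_class => /pt_eval_deg[t _ [lt rt]].
by rewrite /balanced lt rt.
Qed.

Lemma seg_emb_comp n x m : seg_comp n x -> (seg_emb x)@_m != 0 ->
  mdeg (mnm_left m) = n.
Proof.
by move=> [s [Hs ->]]; rewrite seg_emb_class => /pt_eval_deg[t /Hs <- []].
Qed.

Lemma seg_emb_mon m : balanced m -> exists x, seg_emb x = mpolyX k m.
Proof.
move=> /eqP bm.
have Hl : mp_comp (mdeg (mnm_left m)) (mpolyX k (mnm_left m)) by exact: mp_compX.
have Hr : mp_comp (mdeg (mnm_left m)) (mpolyX k (mnm_right m)).
  exact: mp_compX.
exists (seg_class [:: @PureTensor k B C _ _ _ Hl Hr]).
rewrite seg_emb_class pt_eval1 /seg_poly /= inl_mpolyX inr_mpolyX -mpolyXD.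
by rewrite mnm_joinD addm0 add0m mnm_joinK.
Qed.

(* Every bilinear family factors through seg_poly, as its values on pairs of
   monomials define a linear map on polynomials. *)
Definition seg_factor (V : lmodType k) (f : nat -> B -> C -> V) (K : nat)
    (w : mpoly (c + d) k) : V :=
  \sum_(m : bmultinom (c + d) K)
    w@_m *: f (mdeg (mnm_left m)) (mpolyX k (mnm_left m)) (mpolyX k (mnm_right m)).

Lemma seg_factorZD V f K a u v :
  @seg_factor V f K (a *: u + v) = a *: seg_factor f K u + seg_factor f K v.
Proof.
rewrite /seg_factor scaler_sumr -big_split; apply: eq_bigr => m _ /=.
by rewrite mcoeffD mcoeffZ scalerDl scalerA.
Qed.

Lemma seg_factor0 V f K : @seg_factor V f K 0 = 0.
Proof. by rewrite /seg_factor big1 // => m _; rewrite mcoeff0 scale0r. Qed.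

Lemma seg_factorX V f K m : (mdeg m < K)%N -> @seg_factor V f K (mpolyX k m) =
  f (mdeg (mnm_left m)) (mpolyX k (mnm_left m)) (mpolyX k (mnm_right m)).
Proof.
move=> mK; rewrite /seg_factor (bigD1 (BMultinom mK)) //= mcoeffX eqxx scale1r.
rewrite big1 ?addr0 // => m' m'm; rewrite mcoeffX; case: eqVneq => [E'|_].
  by case/eqP: m'm; apply: val_inj.
by rewrite scale0r.
Qed.

Lemma seg_factorP (V : lmodType k) (f : nat -> B -> C -> V) K n b b' :
  bilinear_family f -> (n + n < K)%N -> mp_comp n b -> mp_comp n b' ->
  f n b b' = seg_factor f K (seg_poly n b b').
Proof.
move=> bf nK Hb Hb'; move: b' Hb' b Hb; apply: homog_ind.
- move=> b Hb; rewrite /seg_poly rmorph0 mulr0 seg_factor0.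
  have := bf.2 n (-1) b 0 0 Hb (ga_comp0 C n) (ga_comp0 C n).
  by rewrite mulr0 addr0 scaleN1r addNr.
- move=> a b1 b2 H1 H2 Y1 Y2 b Hb; rewrite (bf.2 n a b b1 b2 Hb H1 H2) (Y1 b Hb) (Y2 b Hb).
  by rewrite -seg_factorZD /seg_poly rmorphD rmorphM /= inr_mpolyC mulrDr mulrCA mul_mpolyC.
move=> m' m'n; have Hm' : mp_comp n (mpolyX k m') by exact: mp_compX.
apply: homog_ind.
- rewrite /seg_poly rmorph0 mul0r seg_factor0.
  exact: (bilinear_family0l bf (Hm' : ga_comp (g := C) n _)).
- move=> a b1 b2 H1 H2 Y1 Y2; rewrite (bf.1 n a b1 b2 _ H1 H2 Hm') Y1 Y2.
  by rewrite -seg_factorZD /seg_poly rmorphD rmorphM /= inl_mpolyC mulrDl -mulrA mul_mpolyC.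
move=> m mn; rewrite /seg_poly inl_mpolyX inr_mpolyX -mpolyXD mnm_joinD addm0 add0m.
rewrite seg_factorX ?mnm_left_join ?mnm_right_join ?mn //.
by rewrite mdeg_split mnm_left_join mnm_right_join mn m'n.
Qed.

(** Elements of the Segre product are separated by bilinear families, whose values are recovered
    from [seg_emb] by linear maps. *)
Lemma seg_emb_inj : injective seg_emb.
Proof.
move=> x y xy; apply/subr0_eq; have : seg_emb (x - y) = 0 by rewrite rmorphB /= xy subrr.
rewrite -[x - y]seg_reprK; set s := seg_repr _; rewrite seg_emb_class => s0.
apply: seg_ext => V f bf; rewrite seg_evalE // seg_eval0 //.
(* K exceeds the total degree 2 deg t of the image of every term t, as [seg_factorP] requires. *)
pose K := (\max_(t <- s) (pt_deg t + pt_deg t).+1)%N.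
rewrite -[RHS](seg_factor0 f K) -s0 /pt_eval.
rewrite (big_morph (seg_factor f K) (op1 := +%R) (id1 := 0)); last 2 first.
- by move=> u v; rewrite -[u]scale1r seg_factorZD !scale1r.
- exact: seg_factor0.
rewrite big_seq [RHS]big_seq; apply: eq_bigr => t ts.
apply: (seg_factorP bf _ (pt_lP t) (pt_rP t)).
by apply: (@leq_bigmax_seq _ s xpredT (fun t => (pt_deg t + pt_deg t).+1) t).
Qed.

Definition segre_monomial_algebra :
    monomial_algebra k balanced (segre_product B C) :=
  @MonomialAlgebra k (c + d) balanced (segre_product B C) (seg_str B C) seg_emb
    seg_emb_inj seg_emb_str seg_emb_balanced seg_emb_mon.

End SegreEmbedding.

(** * Dimension, lengths and the homogeneous maximal ideal of the Segre product *)

Section SegreHilbertKunz.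
Variables (k : fieldType) (c d : nat).
Hypotheses (hc : (1 <= c)%N) (hcd : (c <= d)%N).
Local Notation S := (segre_product (poly_graded k c) (poly_graded k d)).
Local Notation E := (segre_monomial_algebra k c d).
Local Notation P := (irrelevant E).

Lemma mdeg_mnm_of n (f : 'I_n -> nat) : mdeg (mnm_of f) = (\sum_i f i)%N.
Proof. by rewrite mdegE; apply: eq_bigr => i _; rewrite mnm_ofE. Qed.

Lemma leq_mdeg n (m : multinom n) i : (m i <= mdeg m)%N.
Proof. by rewrite mdegE (bigD1 i) //= leq_addr. Qed.

(* The last exponent of a balanced monomial is determined by the others. *)
Lemma balanced_cover (t : nat) : exists l (mm : 'I_l -> multinom (c + d)),
  (l <= t.+1 ^ (c + d - 1))%N /\
  forall m, balanced m -> (mdeg m <= t)%N -> exists i, m = mm i.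
Proof.
set L := (c + d - 1)%N; pose F := {ffun 'I_L -> 'I_t.+1}.
pose g (f : F) (i : nat) : nat := if insub i is Some j then f j else 0%N.
(* The last exponent is the degree in x minus the other y-exponents; [g] is 0 at index L, so the
   subtracted sum leaves that exponent out. *)
pose mk (f : F) : multinom (c + d) := mnm_of (fun i : 'I_(c + d) => if (i < L)%N then g f i
  else (\sum_(i < c) g f i - \sum_(j < d) g f (c + j))%N).
exists #|{: F}|, (fun i => mk (enum_val i)); split.
  by rewrite card_ffun !card_ord.
move=> m bm mt.
pose w (i : nat) : nat := if insub i is Some j then m j else 0%N.
have wE (i : 'I_(c + d)) : w i = m i by rewrite /w valK.
pose f : F := [ffun i : 'I_L => inord (w i)].
exists (enum_rank f); rewrite enum_rankK.
have gE i : (i < L)%N -> g f i = w i.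
  move=> iL; rewrite /g insubT ffunE /= inordK // ltnS.
  have ic : (i < c + d)%N by rewrite (leq_trans iL) ?leq_subr.
  by rewrite -[i]/(val (Ordinal ic)) wE (leq_trans (leq_mdeg m _)).
have g0 i : (L <= i)%N -> g f i = 0%N.
  by move=> Li; rewrite /g insubF // ltnNge Li.
apply/mnmP => i; rewrite mnm_ofE; case: ltnP => iL; first by rewrite gE // wE.
have -> : (\sum_(i < c) g f i = mdeg (mnm_left m))%N.
  rewrite mdeg_mnm_of; apply: eq_bigr => j _; rewrite gE -?wE //.
  by have := ltn_ord j; rewrite /L; lia.
rewrite (eqP bm) mdeg_mnm_of; have d0 : (d.-1 < d)%N by lia.
have iE : i = rshift c (Ordinal d0).
  by apply: val_inj => /=; have := ltn_ord i; move: iL; rewrite /L; lia.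
rewrite (bigD1 (Ordinal d0)) //= [X in (_ - X)%N](bigD1 (Ordinal d0)) //=.
rewrite (@g0 (c + d.-1)%N); last by rewrite /L; lia.
rewrite add0n -iE [X in (_ - X)%N](_ : _ = \sum_(j < d | j != Ordinal d0) m (rshift c j))%N.
  by rewrite addnK.
apply: eq_bigr => j /eqP jd; rewrite gE -?wE //.
have := ltn_ord j; suff : j != d.-1 :> nat by rewrite /L; lia.
by apply/eqP => jE; apply: jd; apply: val_inj.
Qed.

Definition mnm_pair (i : 'I_c) (j : 'I_d) : multinom (c + d) :=
  mnm_join (mnm1 i) (mnm1 j).

Lemma balanced_pair i j : balanced (mnm_pair i j).
Proof. by rewrite /balanced mnm_left_join mnm_right_join !mdeg1. Qed.

(* Killing successively x_1, ..., x_{c-1}, y_0, ..., y_{d-1}, in the indexing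
   of the variables x_0, ..., x_{c-1}, y_0, ..., y_{d-1}. *)
Lemma segre_krull_dim : is_krull_dim (loc P) (c + d - 1).
Proof.
apply: (@monomial_krull_dim _ _ _ _ E _ (fun j i => (0 < i <= j)%N)).
- exact: balanced_cover.
- by move=> j i /andP[-> /leqW].
(* The monomial x_a y_b contains the variable of index j + 1, paired with one still alive: y_0 while
   an x is being killed, afterwards x_0, which is never killed. *)
move=> j jL; have [a [b Hab]] : exists (a : 'I_c) (b : 'I_d),
    if (j.+1 < c)%N then a = j.+1 :> nat else a = 0%N :> nat /\ (c + b)%N = j.+1.
  case: ltnP => jc; first by exists (Ordinal jc), (Ordinal (leq_trans hc hcd)).
  have bd : (j.+1 - c < d)%N by lia.
  by exists (Ordinal hc), (Ordinal bd); split=> //=; lia.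
exists (mnm_pair a b); split; first exact: balanced_pair.
  apply/avoidsP => i; case: (split_ordP i) => i' -> /=.
    rewrite /mnm_pair mnm_join_l mnm1E; case: (eqVneq a i') => // <-.
    by move: Hab; case: ifP; lia.
  rewrite /mnm_pair mnm_join_r mnm1E; case: (eqVneq b i') => // <-.
  by move: Hab; have := ltn_ord b; case: ifP; lia.
apply/avoidsP => H; move: Hab; case: ifP => jc => [aj|[a0 bj]].
  have := H (lshift d a); rewrite /mnm_pair mnm_join_l mnm1E eqxx /= aj.
  by rewrite leqnn => /(_ isT).
have := H (rshift c b); rewrite /mnm_pair mnm_join_r mnm1E eqxx /= bj.
by rewrite leqnn => /(_ isT).
Qed.

(* Pairs of exponent vectors of the balanced monomials outside the q-th Frobenius
   power; the bound d q on the exponents is automatic and only makes the type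
   finite. *)
Definition box_pred (q : nat) :
    pred ({ffun 'I_c -> 'I_(d * q).+1} * {ffun 'I_d -> 'I_(d * q).+1}) :=
  fun u => (\sum_i u.1 i == \sum_j u.2 j)%N &&
    ([forall i, (u.1 i < q)%N] || [forall j, (u.2 j < q)%N]).

(** The monomial (x_i y_j)^q divides m, and the quotient is balanced since both are. *)
Lemma frob_mult_pair (p e : nat) (m : multinom (c + d)) i j :
  balanced m -> (p ^ e <= m (lshift d i))%N -> (p ^ e <= m (rshift c j))%N ->
  @frob_mult _ (@balanced c d) p e m.
Proof.
move=> bm mi mj; set q := (p ^ e)%N in mi mj *.
have le : forall h, (mnm_muln (mnm_pair i j) q h <= m h)%N.
  move=> h; rewrite mulmnE; case: (split_ordP h) => h' ->.
    rewrite /mnm_pair mnm_join_l mnm1E; case: eqVneq => [<-|_] //; first by rewrite mul1n.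
  rewrite /mnm_pair mnm_join_r mnm1E; case: eqVneq => [<-|_] //; first by rewrite mul1n.
have mE : m = mnm_add (mnm_muln (mnm_pair i j) q) (mnm_sub m (mnm_muln (mnm_pair i j) q)).
  by apply/mnmP => h; rewrite mnmDE mnmBE subnKC.
exists (mnm_pair i j), (mnm_sub m (mnm_muln (mnm_pair i j) q)); split=> //.
- exact: balanced_pair.
- have lD (m1 m2 : multinom (c + d)) : mdeg (mnm_left (mnm_add m1 m2)) =
      (mdeg (mnm_left m1) + mdeg (mnm_left m2))%N.
    by rewrite !mdeg_mnm_of -big_split; apply: eq_bigr => h _; rewrite mnmDE.
  have rD (m1 m2 : multinom (c + d)) : mdeg (mnm_right (mnm_add m1 m2)) =
      (mdeg (mnm_right m1) + mdeg (mnm_right m2))%N.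
    by rewrite !mdeg_mnm_of -big_split; apply: eq_bigr => h _; rewrite mnmDE.
  have bq : balanced (mnm_muln (mnm_pair i j) q) := balM E q (balanced_pair i j).
  move: bm; rewrite /balanced {1 2}mE lD rD (eqP bq).
  by rewrite eqn_add2l.
apply/eqP => /mnmP/(_ (lshift d i)).
by rewrite /mnm_pair mnm_join_l mnm1E mnm0E eqxx.
Qed.

(** A non-constant balanced monomial involves some x and some y, so multiples of its q-th power have
    exponents at least q on both sides; [frob_mult_pair] is the converse. *)
Lemma segre_frobenius_length (p e : nat) : p \in [pchar k] ->
  is_length (quotmod (extend_ideal (@to_loc S P) (frobenius_power (p ^ e) P)))
    #|@box_pred (p ^ e)|.
Proof.
move=> chp; have q0 : (0 < p ^ e)%N by rewrite expn_gt0 (prime_gt0 (pcharf_prime chp)).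
set q := (p ^ e)%N in q0 *.
pose mk (u : {ffun 'I_c -> 'I_(d * q).+1} * {ffun 'I_d -> 'I_(d * q).+1}) :=
  mnm_join (mnm_of (fun i => u.1 i)) (mnm_of (fun j => u.2 j)).
have mkl u i : mk u (lshift d i) = u.1 i by rewrite /mk mnm_join_l mnm_ofE.
have mkr u j : mk u (rshift c j) = u.2 j by rewrite /mk mnm_join_r mnm_ofE.
have mk_inj : injective mk.
  move=> [f g] [f' g'] H; congr pair; apply/ffunP => i; apply: val_inj => /=.
    by rewrite -(mkl (f, g)) H mkl.
  by rewrite -(mkr (f, g)) H mkr.
rewrite cardE -(size_map mk); apply: frobenius_length => //.
  by rewrite map_inj_uniq // enum_uniq.
move=> m; split.
  move=> /mapP[u]; rewrite mem_enum => /andP[su bu] ->; split.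
    by rewrite /balanced mnm_left_join mnm_right_join !mdeg_mnm_of.
  move=> [m1 [m2 [b1 _ m10 mE]]]; case/orP: bu => /forallP H.
    have : mdeg (mnm_left m1) != 0%N.
      by apply: contra m10 => l0; rewrite -mdeg_eq0 mdeg_split -(eqP b1) (eqP l0).
    rewrite mdeg_mnm_of sum_nat_eq0 negb_forall => /existsP[i /= i0].
    have := H i; rewrite -mkl mE mnmDE mulmnE; rewrite -/q; nia.
  have : mdeg (mnm_right m1) != 0%N.
    by apply: contra m10 => l0; rewrite -mdeg_eq0 mdeg_split (eqP b1) (eqP l0).
  rewrite mdeg_mnm_of sum_nat_eq0 negb_forall => /existsP[i /= i0].
  have := H i; rewrite -mkr mE mnmDE mulmnE; rewrite -/q; nia.
move=> [bm nf].
have box : [forall i : 'I_c, (m (lshift d i) < q)%N] ||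
    [forall j : 'I_d, (m (rshift c j) < q)%N].
  rewrite -[_ || _]negbK negb_or !negb_forall; apply/andP => -[/existsP[i] + /existsP[j]].
  by rewrite -!leqNgt => mi mj; apply: nf; apply: frob_mult_pair mi mj.
(* Computed on the side whose exponents are below q, the common degree is at most c q or d q. *)
have ldq : (mdeg (mnm_left m) <= d * q)%N.
  case/orP: box => /forallP H; last rewrite (eqP bm).
    rewrite mdeg_mnm_of (leq_trans (leq_sum _ (fun i _ => ltnW (H i)))) //.
    by rewrite sum_nat_const card_ord leq_mul2r hcd orbT.
  rewrite mdeg_mnm_of (leq_trans (leq_sum _ (fun i _ => ltnW (H i)))) //.
  by rewrite sum_nat_const card_ord.
pose u : {ffun 'I_c -> 'I_(d * q).+1} * {ffun 'I_d -> 'I_(d * q).+1} :=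
  ([ffun i => inord (m (lshift d i))], [ffun j => inord (m (rshift c j))]).
have ul i : u.1 i = m (lshift d i) :> nat.
  rewrite ffunE inordK // ltnS; apply: leq_trans ldq.
  by apply: leq_trans (leq_mdeg _ i); rewrite mnm_ofE.
have ur j : u.2 j = m (rshift c j) :> nat.
  rewrite ffunE inordK // ltnS; apply: leq_trans ldq; rewrite (eqP bm).
  by apply: leq_trans (leq_mdeg _ j); rewrite mnm_ofE.
have -> : m = mk u.
  by apply/mnmP => i; case: (split_ordP i) => j ->; rewrite ?mkl ?mkr ?ul ?ur.
rewrite mem_map // mem_enum; apply/andP; split.
  rewrite (eq_bigr _ (fun i _ => ul i)) [X in _ == X](eq_bigr _ (fun i _ => ur i)).
  by move: bm; rewrite /balanced !mdeg_mnm_of.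
case/orP: box => /forallP H; apply/orP; [left|right]; apply/forallP => i.
  by rewrite ul.
by rewrite ur.
Qed.

Lemma segre_coeff0 n (x : S) : ga_comp n x -> (E x)@_(@mnm0 (c + d)) != 0 -> n = 0%N.
Proof.
move=> Sx /(seg_emb_comp Sx) <-; rewrite mdeg_mnm_of big1 // => i _.
by rewrite mnm0E.
Qed.

Lemma segre_comp0 (x : S) : ga_comp 0%N x ->
  x = ma_str E (E x)@_(@mnm0 (c + d)).
Proof.
move=> Sx; apply: (@ma_inj _ _ _ _ E); rewrite ma_embC; apply/mpolyP => m.
rewrite mcoeffC; have [->|m0] := eqVneq m (@mnm0 _); first by rewrite mulr1.
rewrite mulr0; apply/eqP/negPn/negP => Hm; case/negP: m0.
have l0 := seg_emb_comp Sx Hm; have /eqP b0 := ma_bal Hm.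
by rewrite -mdeg_eq0 mdeg_split -b0 l0.
Qed.

Lemma segre_irrelevant_homogeneous : is_homogeneous (A := S) P.
Proof.
move=> N y Hy /irrelevantP; rewrite ma_coeff_sum => H i iN.
apply/irrelevantP; apply/eqP/negPn/negP => yi.
have i0 := segre_coeff0 (Hy i) yi; subst i.
move: H; rewrite (bigD1 (Ordinal iN)) //= big1 => [/eqP|j j0].
  by rewrite addr0 (negbTE yi).
apply/eqP/negPn/negP => /(segre_coeff0 (Hy j)) jE.
by case/eqP: j0; apply: val_inj.
Qed.

(** A homogeneous J contains the degree-0 components of its elements; these are scalars, hence zero
    as J is proper. So J lies in P, and maximality of J gives equality. *)
Lemma segre_irrelevant_unique (J : submodClosed (S : comPzRingType)^o) :
  is_maximal J -> is_homogeneous (A := S) J -> J =i P.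
Proof.
move=> [J1 Jmax] hJ; have JP : {subset J <= P}.
  move=> x Jx; have [N [y [Hy xE]]] := ga_decomp x.
  apply/irrelevantP; rewrite xE ma_coeff_sum big1 // => i _.
  apply/eqP/negPn/negP => yi; have i0 := segre_coeff0 (Hy i) yi.
  have := hJ N y Hy; rewrite -xE => /(_ Jx _ (ltn_ord i)) Jy.
  have y0 : ga_comp 0%N (y i) by have := Hy i; rewrite {1}i0.
  rewrite (segre_comp0 y0) in Jy; have c0 := str_in_ideal J1 Jy.
  by rewrite c0 eqxx in yi.
move=> x; apply/idP/idP; first exact: JP.
by apply: Jmax => //; case: (primeP P).
Qed.

Lemma segre_HK (R : realType) (p : nat) (v : R) : p \in [pchar k] ->
  (((fun e : nat => #|@box_pred (p ^ e)|%:R / (p ^ e)%:R ^+ (c + d - 1)) : nat -> R)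
     @ \oo --> v)%classic ->
  is_HK S p v.
Proof.
move=> chp lim_v; exists P; split.
- exact: irrelevant_maximal.
- exact: segre_irrelevant_homogeneous.
- exact: segre_irrelevant_unique.
exists (c + d - 1)%N, (fun e => #|@box_pred (p ^ e)|); split=> //.
  exact: segre_krull_dim.
by move=> e; apply: segre_frobenius_length.
Qed.

End SegreHilbertKunz.

(** * Counting exponent vectors by polynomial coefficients *)

Section GeometricCoefficients.

(** This expands H / (1 - X)^(L+1) without power series. Multiplication by 1 - X takes differences
    of coefficients, so F is recovered by summation, which Pascal's rule carries out. *)
Lemma coef_div_one_sub (F H : {poly int}) (L s : nat) :
  F * (1 - 'X) ^+ L.+1 = H ->
  F`_s = \sum_(t < s.+1) H`_t * 'C(s - t + L, L)%:R.
Proof.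
have step (G : {poly int}) n : (G * (1 - 'X))`_n.+1 = G`_n.+1 - G`_n.
  by rewrite mulrBr mulr1 coefB coefMX.
have step0 (G : {poly int}) : (G * (1 - 'X))`_0 = G`_0.
  by rewrite mulrBr mulr1 coefB coefMX subr0.
elim: L F H s => [|L IH] F H s FH.
  have FE n : F`_n = \sum_(t < n.+1) H`_t.
    elim: n => [|n IHn]; first by rewrite big_ord1 -FH expr1 step0.
    by rewrite big_ord_recr /= -IHn -FH expr1 step addrC subrK.
  by rewrite FE; apply: eq_bigr => t _; rewrite bin0 mulr1.
have {}IH n := IH (F * (1 - 'X)) H n; rewrite -mulrA -exprS in IH.
elim: s => [|s IHs].
  by have := IH 0%N FH; rewrite step0 => ->; rewrite !big_ord1 !binn.
have := IH s.+1 FH; rewrite step => /eqP; rewrite subr_eq => /eqP ->.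
rewrite IHs big_ord_recr [RHS]big_ord_recr /= addrAC !subnn !binn.
congr (_ + _); rewrite -big_split; apply: eq_bigr => t _ /=.
have ts := ltn_ord t; rewrite -mulrDr -natrD; congr (_ * _%:R).
have -> : (s.+1 - t + L.+1 = (s - t + L.+1).+1)%N by lia.
by rewrite binS addnC; congr ('C(_, _) + 'C(_, _))%N; lia.
Qed.

Definition geo (q : nat) : {poly int} := \sum_(i < q) 'X^i.

Lemma geoE q : geo q * (1 - 'X) = 1 - 'X^q.
Proof.
by apply/eqP; rewrite -eqr_opp -mulrN !opprB mulrC subrX1.
Qed.

Lemma geo_rev (q K : nat) : (q <= K)%N ->
  geo q = \sum_(k < K) (if (k < q)%N then 'X^(q - k.+1) else 0).
Proof.
move=> qK; rewrite /geo (reindex_inj rev_ord_inj) /=.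
by rewrite (big_ord_widen K (fun k => 'X^(q - k.+1)) qK) big_mkcond.
Qed.

Lemma geo_widen (q K : nat) : (q <= K)%N ->
  geo q = \sum_(k < K) (if (k < q)%N then 'X^k else 0).
Proof.
by move=> qK; rewrite /geo (big_ord_widen K (fun k => 'X^k) qK) big_mkcond.
Qed.

Lemma prod_if_monomial (n K q : nat) (w : 'I_K -> nat) :
  \prod_(i < n) \sum_(k < K) (if (k < q)%N then 'X^(w k) else 0) =
  \sum_(f : {ffun 'I_n -> 'I_K})
    (if [forall i, (f i < q)%N] then 'X^(\sum_i w (f i)) else 0 : {poly int}).
Proof.
rewrite bigA_distr_bigA; apply: eq_bigr => f _; case: ifP => [/forallP H|/negbT].
  by rewrite -[RHS]prodrXr; apply: eq_bigr => i _; rewrite H.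
by rewrite negb_forall => /existsP[i /negbTE fi]; rewrite (bigD1 i) //= fi mul0r.
Qed.

(* Substituting q - 1 - f for f turns the condition that f and g have the same
   sum into the condition that the sums add up to c (q - 1). *)
Lemma card_equal_sums (c d K q r : nat) : (q <= K)%N -> (r <= K)%N ->
  (#|[pred u : {ffun 'I_c -> 'I_K} * {ffun 'I_d -> 'I_K} |
      [&& (\sum_i u.1 i == \sum_j u.2 j)%N, [forall i, (u.1 i < q)%N]
        & [forall j, (u.2 j < r)%N]]]|%:R : int) =
  (geo q ^+ c * geo r ^+ d)`_(c * (q - 1)).
Proof.
move=> qK rK.
have powE n (x : {poly int}) : x ^+ n = \prod_(i < n) x by rewrite prodr_const card_ord.
rewrite !powE (geo_rev qK) (geo_widen rK) !prod_if_monomial mulr_suml coef_sum.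
pose F (f : {ffun 'I_c -> 'I_K}) (g : {ffun 'I_d -> 'I_K}) : int :=
  [&& (\sum_i f i == \sum_j g j)%N, [forall i, (f i < q)%N]
    & [forall j, (g j < r)%N]]%:R.
transitivity (\sum_f \sum_g F f g).
  rewrite pair_bigA -sum1_card natr_sum big_mkcond; apply: eq_bigr => u _ /=.
  by rewrite inE /F; case: [&& _, _ & _].
apply: eq_bigr => f _; rewrite mulr_sumr coef_sum; apply: eq_bigr => g _.
rewrite /F; case: (boolP [forall i, (f i < q)%N]) => [/forallP fq|_]; last first.
  by rewrite andbF mul0r coef0.
case: (boolP [forall j, _]) => _; last by rewrite !andbF mulr0 coef0.
rewrite !andbT -exprD coefXn mulrb.
have : (\sum_i (q - (f i).+1) + \sum_i f i = c * (q - 1))%N.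
  rewrite -big_split /= -[X in (X * _)%N]card_ord -sum_nat_const.
  by apply: eq_bigr => i _; move: (fq i) => /=; case: (f i) => z /= _; lia.
by move=> <-; rewrite eqn_add2l; case: eqP.
Qed.

(* The coefficient of X^M in X^s / (1 - X)^(L + 1). *)
Definition big_binom (L M s : nat) : int := if (s <= M)%N then 'C(M - s + L, L)%:R else 0.

Lemma sum_coef_expand (I : finType) (a : I -> int) (h : I -> nat) (M L : nat) :
  \sum_(t < M.+1) (\sum_i (a i)%:P * 'X^(h i) : {poly int})`_t * 'C(M - t + L, L)%:R =
  \sum_i a i * big_binom L M (h i).
Proof.
under eq_bigr => t _ do rewrite coef_sum mulr_suml.
rewrite exchange_big; apply: eq_bigr => i _ /=; rewrite /big_binom.
case: leqP => [hM|Mh].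
  rewrite (bigD1 (Ordinal (hM : (h i < M.+1)%N))) //= coefCM coefXn eqxx mulr1.
  rewrite big1 ?addr0 // => t ti; rewrite coefCM coefXn.
  case: eqP => [tE|_]; last by rewrite mulr0 mul0r.
  by case/eqP: ti; apply: val_inj.
rewrite mulr0 big1 // => t _; rewrite coefCM coefXn.
by case: eqP => [tE|_]; [have := ltn_ord t; lia | rewrite mulr0 mul0r].
Qed.

Lemma one_sub_Xn_expand (n q : nat) : (1 - 'X^q) ^+ n =
  \sum_(j < n.+1) ((-1) ^+ j * 'C(n, j)%:R)%:P * 'X^(j * q) :> {poly int}.
Proof.
rewrite exprDn; apply: eq_bigr => j _.
rewrite expr1n mul1r (exprNn ('X^q)) -exprM [(q * _)%N]mulnC rmorphM rmorphXn rmorphN1 /=.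
by rewrite -mulr_natr rmorph_nat mulrAC.
Qed.

Lemma coef_geo_pair (c d q : nat) (M : nat) : (0 < c + d)%N ->
  (geo q ^+ c * geo q ^+ d)`_M =
  \sum_(i < c.+1) \sum_(j < d.+1)
    (-1) ^+ (i + j) * 'C(c, i)%:R * 'C(d, j)%:R *
      big_binom (c + d - 1) M ((i + j) * q).
Proof.
move=> cd0; rewrite (@coef_div_one_sub _ ((1 - 'X^q) ^+ c * (1 - 'X^q) ^+ d) (c + d - 1)).
  rewrite !one_sub_Xn_expand pair_bigA /=.
  rewrite -(sum_coef_expand (fun u : 'I_c.+1 * 'I_d.+1 =>
    (-1) ^+ (u.1 + u.2) * 'C(c, u.1)%:R * 'C(d, u.2)%:R) (fun u => ((u.1 + u.2) * q)%N)).
  apply: eq_bigr => t _; congr ((_ : {poly int})`_t * _).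
  transitivity (\sum_(i < c.+1) \sum_(j < d.+1)
    ((-1) ^+ (i + j) * 'C(c, i)%:R * 'C(d, j)%:R)%:P * 'X^((i + j) * q) : {poly int});
    last by rewrite pair_bigA.
  rewrite big_distrlr /=; apply: eq_bigr => i _; apply: eq_bigr => j _.
  by rewrite mulrACA -polyCM -exprD -mulnDl; congr (_%:P * _); rewrite mulrACA -exprD mulrA.
have -> : ((c + d - 1).+1 = c + d)%N by lia.
by rewrite exprD mulrACA -!exprMn geoE.
Qed.

(** The factor (1 - X^K)^d is 1 modulo X^K, so it does not affect coefficients below K. *)
Lemma coef_geo_large (c d q K M : nat) : (0 < c + d)%N -> (M < K)%N ->
  (geo q ^+ c * geo K ^+ d)`_M =
  \sum_(j < c.+1) (-1) ^+ j * 'C(c, j)%:R * big_binom (c + d - 1) M (j * q).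
Proof.
move=> cd0 MK; rewrite (@coef_div_one_sub _ ((1 - 'X^q) ^+ c * (1 - 'X^K) ^+ d) (c + d - 1)).
  rewrite -(sum_coef_expand (fun j : 'I_c.+1 => (-1) ^+ j * 'C(c, j)%:R) (fun j => (j * q)%N)).
  apply: eq_bigr => t _; congr (_ * _); rewrite -one_sub_Xn_expand.
  have [w ->] : exists w : {poly int}, (1 - 'X^K) ^+ d = 1 + 'X^K * w.
    elim: d {cd0} => [|d [w IH]]; first by exists 0; rewrite mulr0 addr0.
    by exists (w - 1 - 'X^K * w); rewrite exprS IH; ring.
  rewrite mulrDr mulr1 coefD mulrCA coefXnM ifT ?addr0 //.
  by apply: leq_trans (ltn_ord t) _.
have -> : ((c + d - 1).+1 = c + d)%N by lia.
by rewrite exprD mulrACA -!exprMn !geoE.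
Qed.

Lemma card_box (c d q : nat) : (0 < c <= d)%N -> (0 < q)%N ->
  (#|@box_pred c d q|%:R : int) =
  \sum_(j < c.+1) (-1) ^+ j * 'C(c, j)%:R * big_binom (c + d - 1) (c * (q - 1)) (j * q)
  + \sum_(j < d.+1) (-1) ^+ j * 'C(d, j)%:R * big_binom (c + d - 1) (d * (q - 1)) (j * q)
  - \sum_(i < c.+1) \sum_(j < d.+1)
      (-1) ^+ (i + j) * 'C(c, i)%:R * 'C(d, j)%:R *
        big_binom (c + d - 1) (c * (q - 1)) ((i + j) * q).
Proof.
move=> /andP[c0 cd] q0; set K := (d * q).+1.
(* The bound K is automatic by typing: [cnt q K] constrains only the x-exponents and [cnt K q] only
   the y-exponents. *)
pose cnt q r := [set u : {ffun 'I_c -> 'I_K} * {ffun 'I_d -> 'I_K} |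
      [&& (\sum_i u.1 i == \sum_j u.2 j)%N, [forall i, (u.1 i < q)%N]
        & [forall j, (u.2 j < r)%N]]].
have qK : (q <= K)%N by rewrite /K; nia.
have all_lt (n : nat) (f : {ffun 'I_n -> 'I_K}) : [forall i, (f i < K)%N].
  by apply/forallP => i.
have -> : #|@box_pred c d q| = #|cnt q K :|: cnt K q|.
  by apply: eq_card => u; rewrite !inE !all_lt !andbT -andb_orr.
have := cardsUI (cnt q K) (cnt K q).
have -> : cnt q K :&: cnt K q = cnt q q.
  by apply/setP => u; rewrite !inE !all_lt !andbT andbACA andbb.
move=> /(congr1 (fun n : nat => n%:R : int)); rewrite !natrD => /eqP.
rewrite eq_sym -subr_eq => /eqP <-; rewrite !cardsE.
congr (_ + _ - _).
- by rewrite card_equal_sums // coef_geo_large //; rewrite ?/K; nia.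
(* Swapping the two families brings this count to the previous form, with c and d exchanged. *)
- rewrite -(card_imset _ (can_inj (g := fun u => (u.2, u.1)) (f := fun u => (u.2, u.1)) _)); last by case.
  rewrite (@eq_card _ _ [pred u : {ffun 'I_d -> 'I_K} * {ffun 'I_c -> 'I_K} |
      [&& (\sum_i u.1 i == \sum_j u.2 j)%N, [forall i, (u.1 i < q)%N]
        & [forall j, (u.2 j < K)%N]]]); last first.
    move=> [f g]; apply/imsetP/idP.
      move=> [[f' g']]; rewrite !inE => /and3P[/eqP /= H f1 g1] [-> ->].
      by apply/and3P; split; rewrite //= H.
    move=> /and3P[/eqP /= H f1 g1]; exists (g, f); last by [].
    by apply/and3P; split; rewrite //= H.
  by rewrite card_equal_sums // coef_geo_large 1?addnC //; rewrite ?/K; nia.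
by rewrite card_equal_sums // coef_geo_pair // addn_gt0 c0.
Qed.

End GeometricCoefficients.

(** * Stirling numbers by finite differences *)

Section Stirling.

(** The d-th forward difference of f at 0. *)
Definition alt_sum (d : nat) (f : nat -> int) : int :=
  \sum_(j < d.+1) (-1) ^+ j * 'C(d, j)%:R * f (d - j)%N.

Lemma alt_sumS d f :
  alt_sum d.+1 f = alt_sum d (fun x => f x.+1) - alt_sum d f.
Proof.
rewrite /alt_sum big_ord_recl /= subn0 expr0 bin0 !mul1r.
have -> : \sum_(i < d.+1) (-1) ^+ bump 0 i * 'C(d.+1, bump 0 i)%:R * f (d.+1 - bump 0 i)%N =
    \sum_(i < d.+1) (-1) ^+ i.+1 * 'C(d, i.+1)%:R * f (d - i)%N
    - \sum_(i < d.+1) (-1) ^+ i * 'C(d, i)%:R * f (d - i)%N.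
  rewrite -sumrB; apply: eq_bigr => i _; rewrite /bump add1n binS natrD subSS exprS.
  by ring.
rewrite addrA; congr (_ - _); rewrite big_ord_recr /= bin_small // mulr0 mul0r addr0.
rewrite [RHS]big_ord_recl subn0 expr0 bin0 !mul1r; congr (_ + _).
by apply: eq_bigr => i _; rewrite lift0 subnSK.
Qed.

(** The difference of x^_(j+1) is (j+1) x^_j, so d differences at 0 leave d! when j = d and 0
    otherwise. *)
Lemma alt_sum_ffact d j : alt_sum d (fun x => (x ^_ j)%:R) = ((d == j) * d`!)%:R.
Proof.
have ext (f g : nat -> int) n : f =1 g -> alt_sum n f = alt_sum n g.
  by move=> fg; apply: eq_bigr => i _; rewrite fg.
elim: d j => [|d IH] [|j].
- by rewrite /alt_sum big_ord1 expr0 bin0 !mul1r.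
- by rewrite /alt_sum big_ord1 ffact0n mulr0.
- by rewrite alt_sumS; apply/eqP; rewrite subr_eq0.
rewrite alt_sumS -[X in _ - X]mulr1 /alt_sum mulr1 -sumrB.
transitivity (j.+1%:R * alt_sum d (fun x => (x ^_ j)%:R)).
  rewrite /alt_sum mulr_sumr; apply: eq_bigr => i _.
  set x := (d - i)%N; rewrite -mulrBr ffactSS ffactnSr.
  have [xj|jx] := ltnP x j; first by rewrite ffact_small ?muln0 ?mul0n ?subrr ?mulr0 // .
  by rewrite -[x.+1](subnK (leqW jx)) subSn // !natrM !natrD; ring.
rewrite IH eqSS; case: eqP => [->|_]; last by rewrite !mul0n mulr0.
by rewrite !mul1n factS natrM.
Qed.

Lemma horner_falling (j x : nat) :
  (\prod_(i < j) ('X - (i%:R)%:P : {poly int})).[x%:R] = (x ^_ j)%:R.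
Proof.
elim: j => [|j IH]; first by rewrite big_ord0 hornerC.
rewrite big_ord_recr hornerM IH hornerXsubC ffactnSr natrM.
have [xj|jx] := ltnP x j; first by rewrite ffact_small // !mul0r.
by rewrite natrB.
Qed.

(** The d-th difference at 0 extracts the d-th coefficient of an expansion in falling factorials.
    Being valid for every S with the specification, the formula also proves uniqueness. *)
Lemma stirling2_explicit (S : nat -> nat -> int) (n d : nat) : stirling2_spec S ->
  (d`!)%:R * S n d = alt_sum d (fun x => (x ^ n)%:R).
Proof.
move=> /(_ n)[N [SN XN]].
have -> : alt_sum d (fun x => (x ^ n)%:R) =
    \sum_(j < N) S n j * alt_sum d (fun x => (x ^_ j)%:R).
  rewrite /alt_sum; under [RHS]eq_bigr => j _ do rewrite mulr_sumr.
  rewrite exchange_big; apply: eq_bigr => i _ /=; set x := (d - i)%N.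
  have := congr1 (horner^~ x%:R) XN; rewrite hornerXn -natrX => ->.
  rewrite horner_sum mulr_sumr; apply: eq_bigr => j _.
  by rewrite hornerZ horner_falling mulrCA.
under eq_bigr => j _ do rewrite alt_sum_ffact.
have [Nd|dN] := leqP N d.
  rewrite SN // mulr0 big1 // => j _; case: eqP => [dj|_]; last by rewrite mul0n mulr0.
  by have := ltn_ord j; rewrite -dj ltnNge Nd.
rewrite (bigD1 (Ordinal dN)) //= eqxx mul1n big1 ?addr0 1?mulrC // => j jd.
case: eqP => [dj|_]; last by rewrite mul0n mulr0.
by case/eqP: jd; apply: val_inj.
Qed.

Lemma stirling2_succ (d : nat) : 2%:R * stirling2 d.+1 d = (d * d.+1)%:R.
Proof.
(* [stirling2] comes from a choice and does not compute; uniqueness identifies it with the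
   recursion. *)
have -> : stirling2 d.+1 d = stirling2_rec d.+1 d.
  have fd : (d`!)%:R != 0 :> int by rewrite pnatr_eq0 -lt0n fact_gt0.
  apply: (mulfI fd); rewrite (stirling2_explicit _ _ stirling2P).
  by rewrite (stirling2_explicit _ _ stirling2_rec_spec).
have rec_small n j : (n < j)%N -> stirling2_rec n j = 0.
  by elim: n j => [|n IH] [|j] //= nj; rewrite !IH ?mulr0 ?addr0 // ltnW.
have rec_diag n : stirling2_rec n n = 1.
  by elim: n => [|n IH] //=; rewrite rec_small // mulr0 add0r.
elim: d => [//|d IH].
have -> : stirling2_rec d.+2 d.+1 = d.+1%:R * stirling2_rec d.+1 d.+1 + stirling2_rec d.+1 d by [].
by rewrite rec_diag mulr1 mulrDr IH -natrM -natrD; congr (_%:R); lia.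
Qed.

End Stirling.

(** * Asymptotics of the binomial coefficients *)

Section Limit.
Variables (R : realType) (p : nat).
Hypothesis p_gt1 : (1 < p)%N.

Lemma inv_pow_cvg0 : ((fun e : nat => (p ^ e)%:R^-1 : R) @ \oo --> (0 : R))%classic.
Proof.
have -> : (fun e : nat => (p ^ e)%:R^-1 : R) = (fun e => (p%:R^-1 : R) ^+ e).
  by apply/funext => e; rewrite natrX exprVn.
apply: cvg_expr; rewrite ger0_norm ?invr_ge0 ?ler0n //.
by rewrite invf_lt1 ?ltr1n // ltr0n ltnW.
Qed.

(** For j < a and q = p^e large, the numerator is a product of L factors asymptotic to (a - j) q,
    over L!. For a <= j, j q exceeds a (q - 1), so the coefficient is 0, in agreement with truncated
    subtraction and L > 0. *)
Lemma binom_cvg (L a j : nat) : (0 < L)%N -> (0 < a)%N ->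
  ((fun e : nat => (big_binom L (a * (p ^ e - 1)) (j * p ^ e))%:~R / (p ^ e)%:R ^+ L : R)
     @ \oo --> ((a - j)%N%:R ^+ L / (L`!)%:R : R))%classic.
Proof.
move=> L0 a0; have q0 e : (0 < p ^ e)%N by rewrite expn_gt0 ltnW.
have [aj|ja] := leqP a j.
  have -> : (a - j)%N = 0%N by lia.
  rewrite expr0n gtn_eqF // mul0r.
  rewrite (_ : (fun e : nat => _) = (fun=> 0 : R)); first exact: cvg_cst.
  apply/funext => e; rewrite /big_binom leqNgt (_ : (_ < _)%N) ?mul0r //.
  by have := q0 e; nia.
(* With x = m q - a, the factor x + L - i divided by q is m + s i / q. *)
set m := (a - j)%N; pose s (i : 'I_L) : R := (L - i)%:R - a%:R.
have lim_s : ((fun e : nat => (\prod_(i < L) (m%:R + s i * (p ^ e)%:R^-1)) / (L`!)%:R : R)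
    @ \oo --> (m%:R ^+ L / (L`!)%:R : R))%classic.
  apply: cvgM; last exact: cvg_cst.
  have -> : (m%:R : R) ^+ L = \prod_(i < L) (m%:R + s i * 0).
    by rewrite (eq_bigr (fun=> m%:R)) ?prodr_const ?card_ord // => i _; rewrite mulr0 addr0.
  apply: (@cvg_big _ _ _ _ _ (@mul_continuous R) _ _ _
    (fun i e => m%:R + s i * (p ^ e)%:R^-1) (fun i => m%:R + s i * 0)) => i _; apply: cvgD; first exact: cvg_cst.
  by apply: cvgM; [exact: cvg_cst | exact: inv_pow_cvg0].
apply: cvg_trans lim_s; apply: near_eq_cvg; near=> e.
(* As j < a, the bound j q <= a (q - 1) holds once q >= a. *)
have ae : (a <= p ^ e)%N.
  have ae : (a <= e)%N by near: e; exact: nbhs_infty_ge.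
  by apply: leq_trans ae (ltnW (ltn_expl _ p_gt1)).
have Q0 : ((p ^ e)%:R : R) != 0 by rewrite pnatr_eq0 -lt0n.
rewrite /big_binom; have le : (j * p ^ e <= a * (p ^ e - 1))%N by have := q0 e; nia.
rewrite le; set x := (a * (p ^ e - 1) - j * p ^ e)%N.
have xN : (x + a = m * p ^ e)%N.
  rewrite /x mulnBr muln1 mulnBl; move: le; rewrite mulnBr muln1.
  by have := q0 e; nia.
have xE : (x%:R : R) = m%:R * (p ^ e)%:R - a%:R by rewrite -natrM -xN natrD addrK.
have fL : ((L`!)%:R : R) != 0 by rewrite pnatr_eq0 -lt0n fact_gt0.
apply/esym/(canRL (mulfK fL)).
have -> : ('C(x + L, L)%:R : int)%:~R = 'C(x + L, L)%:R :> R by rewrite rmorph_nat.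
rewrite mulrAC.
rewrite -natrM bin_ffact ffact_prod natr_prod.
have -> : ((p ^ e)%:R : R) ^+ L = \prod_(i < L) (p ^ e)%:R by rewrite prodr_const card_ord.
rewrite -prodf_div; apply: eq_bigr => i _.
rewrite -addnBA; last exact/ltnW/ltn_ord.
by rewrite natrD xE /s; field.
Unshelve. all: end_near.
Qed.

End Limit.

(** * The limit and its closed form *)

Section HilbertKunzValue.
Variable R : realType.

Definition hk_value (c d : nat) : R :=
  (d`!)%:R / ((c + d - 1)`!)%:R * (stirling2 (c + d - 1) d)%:~R
  - (((c + d - 1)`!)%:R)^-1 *
    (\sum_(1 <= i < c.+1) \sum_(1 <= j < i)
      'C(c, i)%:R * 'C(d, j)%:R * (-1) ^+ (c - i + j) * (i - j)%:R ^+ (c + d - 1)).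

Lemma cvg_sum_ord (n : nat) (f : 'I_n -> nat -> R) (l : 'I_n -> R) :
  (forall i, (f i @ \oo --> l i)%classic) ->
  ((fun e => \sum_(i < n) f i e) @ \oo --> \sum_(i < n) l i)%classic.
Proof. by move=> fl; apply: (cvg_big add_continuous). Qed.

Lemma box_cvg (p c d : nat) : (1 < p)%N -> (0 < c <= d)%N ->
  let L := (c + d - 1)%N in
  ((fun e : nat => #|@box_pred c d (p ^ e)|%:R / (p ^ e)%:R ^+ L : R) @ \oo -->
   (\sum_(j < c.+1) (-1) ^+ j * 'C(c, j)%:R * ((c - j)%N%:R ^+ L / (L`!)%:R)
    + \sum_(j < d.+1) (-1) ^+ j * 'C(d, j)%:R * ((d - j)%N%:R ^+ L / (L`!)%:R)
    - \sum_(i < c.+1) \sum_(j < d.+1) (-1) ^+ (i + j) * 'C(c, i)%:R * 'C(d, j)%:R *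
        ((c - (i + j))%N%:R ^+ L / (L`!)%:R) : R))%classic.
Proof.
move=> p1 cd L; have /andP[c0 lecd] := cd.
have d0 : (0 < d)%N by apply: leq_trans lecd.
have L0 : (0 < L)%N by rewrite /L; lia.
pose B a j e : R := (big_binom L (a * (p ^ e - 1)) (j * p ^ e))%:~R / (p ^ e)%:R ^+ L.
have -> : (fun e : nat => #|@box_pred c d (p ^ e)|%:R / (p ^ e)%:R ^+ L : R) =
  (fun e => \sum_(j < c.+1) (-1) ^+ j * 'C(c, j)%:R * B c j e
    + \sum_(j < d.+1) (-1) ^+ j * 'C(d, j)%:R * B d j e
    - \sum_(i < c.+1) \sum_(j < d.+1) (-1) ^+ (i + j) * 'C(c, i)%:R * 'C(d, j)%:R *
        B c (i + j)%N e).
  apply/funext => e; have q0 : (0 < p ^ e)%N by rewrite expn_gt0 ltnW.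
  have -> : #|@box_pred c d (p ^ e)|%:R = (#|@box_pred c d (p ^ e)|%:R : int)%:~R :> R.
    by rewrite rmorph_nat.
  rewrite card_box // rmorphB rmorphD /= !rmorph_sum /= mulrBl mulrDl !mulr_suml.
  congr (_ + _ - _); apply: eq_bigr => i _.
  - by rewrite !rmorphM /= rmorphXn rmorphN1 rmorph_nat /B -!mulrA.
  - by rewrite !rmorphM /= rmorphXn rmorphN1 rmorph_nat /B -!mulrA.
  rewrite rmorph_sum mulr_suml /=; apply: eq_bigr => j _.
  by rewrite !rmorphM /= rmorphXn rmorphN1 !rmorph_nat /B -!mulrA.
have Bcvg a j x : (0 < a)%N -> ((fun e => x * B a j e) @ \oo -->
    (x * ((a - j)%N%:R ^+ L / (L`!)%:R) : R))%classic.
  by move=> a0; apply: cvgM; [exact: cvg_cst | apply: binom_cvg].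
apply: cvgB; first by apply: cvgD; apply: cvg_sum_ord => j; apply: Bcvg.
by do 2!apply: cvg_sum_ord => ?; apply: Bcvg.
Qed.

(* The terms with j = 0 of the double sum cancel the first sum; i is replaced
   by c - i in the others. *)
Lemma hk_valueE (c d : nat) : (0 < c <= d)%N -> let L := (c + d - 1)%N in
  \sum_(j < c.+1) (-1) ^+ j * 'C(c, j)%:R * ((c - j)%N%:R ^+ L / (L`!)%:R)
    + \sum_(j < d.+1) (-1) ^+ j * 'C(d, j)%:R * ((d - j)%N%:R ^+ L / (L`!)%:R)
    - \sum_(i < c.+1) \sum_(j < d.+1) (-1) ^+ (i + j) * 'C(c, i)%:R * 'C(d, j)%:R *
        ((c - (i + j))%N%:R ^+ L / (L`!)%:R) = hk_value c d.
Proof.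
move=> /andP[c0 cd] L; have L0 : (0 < L)%N by rewrite /L; lia.
have tr0 (i j : nat) : (i <= j)%N -> ((i - j)%N%:R : R) ^+ L = 0.
  by move=> ij; rewrite (_ : (i - j)%N = 0%N) ?expr0n ?gtn_eqF //; lia.
(* The sum over d.+1 is d! S(L, d) / L! by the explicit formula; the other two sums must give the
   double sum. *)
rewrite /hk_value -/L addrAC addrC; congr (_ + _).
  rewrite mulrAC -[in RHS](rmorph_nat (intr : int -> R)) -rmorphM /=.
  rewrite (stirling2_explicit _ _ stirling2P) /alt_sum rmorph_sum mulr_suml.
  apply: eq_bigr => j _; rewrite !rmorphM /= rmorphXn rmorphN1 !rmorph_nat.
  by rewrite natrX mulrA.
pose T i j : R := 'C(c, i)%:R * 'C(d, j)%:R * (-1) ^+ (c - i + j) * (i - j)%N%:R ^+ L.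
(* Terms with j >= i vanish by truncated subtraction, so the inner range can be made independent of
   i. *)
have -> : \sum_(1 <= i < c.+1) \sum_(1 <= j < i) T i j =
    \sum_(i < c.+1) \sum_(j < d) T i j.+1.
  rewrite big_ord_recl [X in X + _]big1 ?add0r; last first.
    by move=> j _; rewrite /T /= tr0 // mulr0.
  rewrite big_add1 big_mkord; apply: eq_bigr => i _; rewrite lift0.
  have -> : \sum_(j < d) T i.+1 j.+1 = \sum_(1 <= j < d.+1) T i.+1 j.
    by rewrite big_add1 big_mkord.
  have id1 : (i.+1 <= d.+1)%N by have := ltn_ord i; lia.
  rewrite [RHS](big_cat_nat _ (n := i.+1)) //= [X in _ + X]big_nat [X in _ + X]big1 ?addr0 //.
  by move=> j /andP[ij _]; rewrite /T tr0 // mulr0.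
rewrite -[RHS]mulrN -[X in _ = _ * X]sumrN mulr_sumr [in RHS](reindex_inj rev_ord_inj) /= -sumrB.
apply: eq_bigr => i _; have ic : (i <= c)%N by rewrite -ltnS.
rewrite big_ord_recl /= addn0 bin0 mulr1 opprD addrA subrr add0r.
rewrite -sumrN mulrN mulr_sumr -sumrN; apply: eq_bigr => j _.
rewrite /T /bump /= !add1n subSS bin_sub //.
have -> : (c - (c - i) + j.+1 = i + j.+1)%N by lia.
have -> : (c - i - j.+1 = c - (i + j.+1))%N by lia.
by rewrite -[in LHS]mulrA; ring.
Qed.

(** Only i = 2, j = 1 contributes to the double sum, giving d / (d + 1)!; the first term is d / 2
    because S(d + 1, d) = d (d + 1) / 2. *)
Lemma hk_value2 (d : nat) : (0 < d)%N ->
  hk_value 2 d = d%:R * (1 / 2 + 1 / ((d + 1)`!)%:R).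
Proof.
move=> d0; rewrite /hk_value; have -> : (2 + d - 1 = d.+1)%N by lia.
rewrite big_ltn // big_nat1 big_geq // big_nat1 add0r.
rewrite binn bin1 mul1r subnn add0n expr1 subn1 expr1n mulr1 mulrN1 addn1.
have /(congr1 (fun z : int => z%:~R : R)) := stirling2_succ d.
rewrite rmorphM /= !rmorph_nat natrM => S2.
have -> : (stirling2 d.+1 d)%:~R = d%:R * d.+1%:R / 2 :> R.
  by rewrite -S2 mulrAC divff ?mul1r // pnatr_eq0.
have fd : ((d`!)%:R : R) != 0 by rewrite pnatr_eq0 -lt0n fact_gt0.
have d1 : (d.+1%:R : R) != 0 by rewrite pnatr_eq0.
by rewrite factS natrM; field; rewrite fd -natr1 addrC in d1 *.
Qed.

End HilbertKunzValue.

Theorem theorem3p3 (R : realType) (k : fieldType) (p : nat)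
    (hp : p \in [pchar k]) (c d : nat) (hc : (1 <= c)%N) (hcd : (c <= d)%N) :
  is_HK (segre_product (poly_graded k c) (poly_graded k d)) p
    ((d`!)%:R / ((c + d - 1)`!)%:R * (stirling2 (c + d - 1) d)%:~R
     - (((c + d - 1)`!)%:R)^-1 *
       (\sum_(1 <= i < c.+1) \sum_(1 <= j < i)
          'C(c, i)%:R * 'C(d, j)%:R * (-1) ^+ (c - i + j)
            * (i - j)%:R ^+ (c + d - 1)) : R)
  /\
  (c = 2%N ->
   is_HK (segre_product (poly_graded k c) (poly_graded k d)) p
     (d%:R * (1 / 2 + 1 / ((d + 1)`!)%:R) : R)).
Proof.
have p1 : (1 < p)%N by rewrite prime_gt1 // (pcharf_prime hp).
have cd : (0 < c <= d)%N by rewrite hc.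
have HK : is_HK (segre_product (poly_graded k c) (poly_graded k d)) p (hk_value R c d).
  by apply: segre_HK => //; rewrite -hk_valueE //; apply: box_cvg.
split=> // c2; subst c; rewrite -hk_value2 //.
exact: leq_trans hcd.
Qed.
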